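(* For any ring $R$, the following equality (in $\mathbb{N}\cup\{\infty\}$) holds: $$\sup\{\mathrm{PGF\text{-}pd}_R(M)\mid M\text{ is an }R\text{-module}\}=\sup\{\mathrm{Gpd}_R(M)\mid M\text{ is an }R\text{-module}\}.$$
   Context: $R$ is an associative ring with identity; ''$R$-module'' means unital left $R$-module. An $R$-module is PGF (projectively coresolved Gorenstein flat) if it is a syzygy (kernel of a differential) of an exact (doubly infinite) complex of projective $R$-modules that stays exact after applying $E\otimes_R-$ for every injective right $R$-module $E$. An $R$-module is Gorenstein projective if it is a syzygy of an exact complex of projective $R$-modules that stays exact after applying $\mathrm{Hom}_R(-,P)$ for every projective $R$-module $P$. $\mathrm{PGF\text{-}pd}_R(M)$ (resp. $\mathrm{Gpd}_R(M)$) is the least $k\ge0$ such that there is an exact sequence $0\to G_k\to\cdots\to G_0\to M\to0$ with all $G_i$ PGF (resp. Gorenstein projective), and $\infty$ if no such $k$ exists. *)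

(* Defs.v *)
From HB Require Import structures.
From mathcomp Require Import all_boot all_order all_algebra.
From mathcomp Require Import boolp classical_sets.
From mathcomp Require Import freeg.

(* Rings are [pzRingType]s (associative, unital, the zero ring allowed), left R-modules
   are [lmodType R], and right R-modules are left modules over the converse
   ring, [lmodType R^c]: [a *: e] there stands for e.a. *)

Set Implicit Arguments.
Unset Strict Implicit.
Unset Printing Implicit Defensive.

Import GRing.Theory.

Local Open Scope quotient_scope.
Local Open Scope ring_scope.

(* N \cup {oo}; [None] is oo. *)
Definition enat := option nat.

Definition enat_le (d d' : enat) : bool :=
  match d, d' with
  | _, None => true
  | None, Some _ => false
  | Some k, Some n => (k <= n)%N
  end.

Definition least (P : nat -> Prop) : enat :=
  match pselect (exists n, `[< P n >]) with
  | left exP => Some (ex_minn exP)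
  | right _ => None
  end.

(* The least natural number bounding S, and oo if there is none; the supremum
   of the empty set is 0. *)
Definition esup (S : set enat) : enat :=
  least (fun n => forall d, S d -> enat_le d (Some n)).

Lemma leastP (P : nat -> Prop) (n : nat) :
  least P = Some n <-> P n /\ forall m, P m -> (n <= m)%N.
Proof.
rewrite /least; case: pselect => [exP|nexP]; last first.
  by split=> // -[Pn _]; case: nexP; exists n; apply/asboolP.
case: ex_minnP => k /asboolP Pk kmin; split=> [[<-]|[Pn nmin]].
  by split=> // m Pm; apply/kmin/asboolP.
congr Some; apply/eqP; rewrite eqn_leq nmin // andbT.
exact/kmin/asboolP.
Qed.

Lemma least_None (P : nat -> Prop) : least P = None <-> forall n, ~ P n.
Proof.
rewrite /least; case: pselect => [[n Pn]|nexP]; split=> //.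
  by move=> nP; case: (nP n); apply/asboolP.
by move=> _ n Pn; apply: nexP; exists n; apply/asboolP.
Qed.

Lemma esup_ub (S : set enat) (d : enat) : S d -> enat_le d (esup S).
Proof.
move=> Sd; case E: (esup S) => [n|]; last by case: d {Sd}.
by move/leastP: E => [+ _]; apply.
Qed.

Lemma esup_least (S : set enat) (d : enat) :
  (forall d', S d' -> enat_le d' d) -> enat_le (esup S) d.
Proof.
case: d => [n|] ub; last by case: (esup S).
case E: (esup S) => [k|] /=.
  by move/leastP: E => [_]; apply.
by move/least_None: E => nub; case: (nub n).
Qed.

Section Tensor.
Variable R : pzRingType.

Section Def.
Variables (E : lmodType R^c) (M : lmodType R).

Local Notation F := {freeg (E * M)%type}.
Local Notation gen e m := (<< (e, m) >> : F).

(* The subgroup of the free abelian group on E x M spanned by the defining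
   relations of the tensor product. *)
Inductive tensor_rel : F -> Prop :=
| TensorRel0 : tensor_rel 0
| TensorRelB x y : tensor_rel x -> tensor_rel y -> tensor_rel (x - y)
| TensorRelDl e e' m :
    tensor_rel (gen (e + e') m - (gen e m + gen e' m))
| TensorRelDr e m m' :
    tensor_rel (gen e (m + m') - (gen e m + gen e m'))
| TensorRelZ (a : R) e m :
    tensor_rel (gen ((a : R^c) *: e) m - gen e (a *: m)).

Definition tensor_relb : {pred F} := fun x => `[< tensor_rel x >].

Lemma tensor_relb_closed : zmod_closed tensor_relb.
Proof.
split=> [|x y]; first exact/asboolP/TensorRel0.
by move=> /asboolP xr /asboolP yr; apply/asboolP/TensorRelB.
Qed.

HB.instance Definition _ := GRing.isZmodClosed.Build F tensor_relb
  tensor_relb_closed.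

Definition tensor : zmodType := Quotient.quot tensor_relb.

Definition tmk (e : E) (m : M) : tensor := \pi_tensor (gen e m).

Lemma tmkDl m : {morph (fun e => tmk e m) : e e' / e + e'}.
Proof.
move=> e e'; rewrite /tmk -raddfD; apply/eqP; rewrite -Quotient.idealrBE.
exact/asboolP/TensorRelDl.
Qed.

Lemma tmkDr e : {morph tmk e : m m' / m + m'}.
Proof.
move=> m m'; rewrite /tmk -raddfD; apply/eqP; rewrite -Quotient.idealrBE.
exact/asboolP/TensorRelDr.
Qed.

Lemma tmkZ (a : R) e m : tmk ((a : R^c) *: e) m = tmk e (a *: m).
Proof.
apply/eqP; rewrite -Quotient.idealrBE; exact/asboolP/TensorRelZ.
Qed.

Lemma tensor_ind (P : tensor -> Prop) :
  (forall e m, P (tmk e m)) -> (forall t t', P t -> P t' -> P (t - t')) ->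
  forall t, P t.
Proof.
move=> Pmk PB.
have P0 : P 0 by rewrite -(subrr (tmk 0 0)); apply: PB.
have PN t : P t -> P (- t) by rewrite -sub0r; apply: PB.
have PD t t' : P t -> P t' -> P (t + t').
  by move=> Pt /PN; rewrite -{2}[t']opprK; apply: PB.
elim/quotW=> D; rewrite -[D]freeg_sumE raddf_sum; apply: big_ind => // -[e m] _.
move: (coeff _ _) => k; have PMn n : P (tmk e m *+ n).
  by elim: n => [|n IHn]; rewrite ?mulr0n // mulrS; apply: PD.
have -> : << k *g (e, m) >> = gen e m *~ k by rewrite freegU_mulz intz.
rewrite raddfMz.
by case: k => n; [apply: PMn | rewrite NegzE mulrNz; apply/PN/PMn].
Qed.

Section Lift.
Variables (A : zmodType) (f : E -> M -> A).
Hypothesis fDl : forall m, {morph (fun e => f e m) : e e' / e + e'}.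
Hypothesis fDr : forall e, {morph f e : m m' / m + m'}.
Hypothesis fZ : forall (a : R) e m, f ((a : R^c) *: e) m = f e (a *: m).

Definition free_lift (D : F) : A :=
  fglift (fun p => f p.1 p.2 : zmodule A) D.

Lemma free_lift_is_additive : zmod_morphism free_lift.
Proof. exact (lift_is_additive (fun p => f p.1 p.2 : zmodule A)). Qed.

HB.instance Definition _ :=
  GRing.isZmodMorphism.Build F A free_lift free_lift_is_additive.

Lemma free_liftU e m : free_lift (gen e m) = f e m.
Proof. by rewrite /free_lift liftU /= scale1r. Qed.

Lemma free_lift_rel D : tensor_rel D -> free_lift D = 0.
Proof.
elim=> [|x y _ x0 _ y0|e e' m|e m m'|a e m].
- exact: raddf0.
- by rewrite raddfB /= x0 y0 subrr.
- by rewrite raddfB raddfD /= !free_liftU fDl subrr.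
- by rewrite raddfB raddfD /= !free_liftU fDr subrr.
- by rewrite raddfB /= !free_liftU fZ subrr.
Qed.

Definition tensor_lift (t : tensor) : A := free_lift (repr t).

Lemma tensor_lift_pi (D : F) :
  tensor_lift (\pi_tensor D) = free_lift D.
Proof.
apply/eqP; rewrite -subr_eq0 -raddfB; apply/eqP/free_lift_rel/asboolP.
change (repr (\pi_tensor D) - D \in tensor_relb).
by rewrite Quotient.idealrBE reprK.
Qed.

Lemma tensor_lift_is_additive : zmod_morphism tensor_lift.
Proof.
elim/quotW=> x; elim/quotW=> y.
by rewrite -raddfB !tensor_lift_pi raddfB.
Qed.

Lemma tensor_lift_mk e m : tensor_lift (tmk e m) = f e m.
Proof. by rewrite tensor_lift_pi free_liftU. Qed.

End Lift.
End Def.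

Section Map.
Variables (E : lmodType R^c) (M N : lmodType R) (g : {linear M -> N}).

Definition tensor_map : tensor E M -> tensor E N :=
  tensor_lift (fun e m => tmk e (g m)).

Let gDl m : {morph (fun e : E => tmk e (g m)) : e e' / e + e'}.
Proof. exact: tmkDl. Qed.

Let gDr (e : E) : {morph (fun m => tmk e (g m)) : m m' / m + m'}.
Proof. by move=> m m'; rewrite linearD tmkDr. Qed.

Let gZ (a : R) (e : E) m :
  tmk ((a : R^c) *: e) (g m) = tmk e (g (a *: m)).
Proof. by rewrite linearZ tmkZ. Qed.

Lemma tensor_map_is_additive : zmod_morphism tensor_map.
Proof. exact: tensor_lift_is_additive gDl gDr gZ. Qed.

HB.instance Definition _ :=
  GRing.isZmodMorphism.Build (tensor E M) (tensor E N) tensor_map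
    tensor_map_is_additive.

Lemma tensor_map_mk e m : tensor_map (tmk e m) = tmk e (g m).
Proof. exact: tensor_lift_mk gDl gDr gZ _ _. Qed.

End Map.
End Tensor.

Definition exact_at (A B C : zmodType) (f : A -> B) (g : B -> C) : Prop :=
  forall y, g y = 0 <-> exists x, f x = y.

Definition projective_module (R : pzRingType) (P : lmodType R) : Prop :=
  forall (A B : lmodType R) (g : {linear A -> B}) (f : {linear P -> B}),
    (forall b, exists a, g a = b) ->
    exists h : {linear P -> A}, forall x, g (h x) = f x.

Definition injective_module (R : pzRingType) (E : lmodType R) : Prop :=
  forall (A B : lmodType R) (g : {linear A -> B}) (f : {linear A -> E}),
    injective g ->
    exists h : {linear B -> E}, forall x, h (g x) = f x.

(* A doubly infinite complex, with homological indexing. *)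
Record complex (R : pzRingType) := Complex {
  cobj :> int -> lmodType R;
  cdiff : forall n : int, {linear cobj (n + 1) -> cobj n};
  cdiff_comp : forall n x, cdiff n (cdiff (n + 1) x) = 0 }.

Arguments cdiff {R} c n.

Section Complexes.
Variable R : pzRingType.
Implicit Types (C : complex R) (M : lmodType R).

Definition exact_complex C : Prop :=
  forall n : int, exact_at (cdiff C (n + 1)) (cdiff C n).

Definition tensor_exact (E : lmodType R^c) C : Prop :=
  forall n : int,
    exact_at (tensor_map (cdiff C (n + 1)) : tensor E _ -> tensor E _)
             (tensor_map (cdiff C n)).

(* Hom_R(C, Q) is exact: at Hom_R(C_(n+1), Q), the differentials being
   precomposition with those of C. *)
Definition hom_exact C (Q : lmodType R) : Prop :=
  forall (n : int) (f : {linear C (n + 1) -> Q}),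
    (forall x, f (cdiff C (n + 1) x) = 0) <->
    (exists g : {linear C n -> Q}, forall x, g (cdiff C n x) = f x).

(* M is isomorphic to the kernel of a differential of C. *)
Definition syzygy C M : Prop :=
  exists (n : int) (i : {linear M -> C (n + 1)}),
    injective i /\ exact_at i (cdiff C n).

Definition PGF M : Prop :=
  exists C,
    [/\ forall n, projective_module (C n),
        exact_complex C,
        forall E : lmodType R^c, injective_module E -> tensor_exact E C
      & syzygy C M].

Definition gorenstein_projective M : Prop :=
  exists C,
    [/\ forall n, projective_module (C n),
        exact_complex C,
        forall Q : lmodType R, projective_module Q -> hom_exact C Q
      & syzygy C M].

(* There is an exact sequence 0 -> G_k -> ... -> G_0 -> M -> 0 with all G_i in
   X; the sequence is extended by G_i = 0 for i > k. *)
Definition has_resolution (X : lmodType R -> Prop) M (k : nat) : Prop :=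
  exists (G : nat -> lmodType R) (d : forall i, {linear G i.+1 -> G i})
         (e : {linear G 0%N -> M}),
    [/\ forall i, (i <= k)%N -> X (G i),
        forall i, (k < i)%N -> forall x : G i, x = 0,
        forall i, exact_at (d i.+1) (d i),
        exact_at (d 0%N) e
      & forall m, exists x, e x = m].

Definition PGF_pd M : enat := least (has_resolution PGF M).

Definition Gpd M : enat := least (has_resolution gorenstein_projective M).

End Complexes.

(* Main.v *)
Require Import Defs.
From HB Require Import structures.
From mathcomp Require Import all_boot all_order all_algebra.
From mathcomp Require Import boolp classical_sets functions wochoice.

(** For every natural number n, all modules have PGF-dimension at most n if and only
    if all modules have Gorenstein projective dimension at most n. One implication
    holds since every PGF module is Gorenstein projective, over any ring; for the
    other one, every Gorenstein projective module is PGF as soon as all Gorenstein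
    projective dimensions are bounded.

    PGF modules are Gorenstein projective (PGF_gorenstein_projective). Let C be an
    exact complex of projective modules that stays exact when tensored with
    injective right modules, and L a free module. Products of character modules
    of L are injective right modules, and exactness of the tensor product with
    such a product has a uniform consequence (tensor_local): every finite list t
    of elements of C admits a finite list w such that any cochain of C with values
    in L that is closed on w is a coboundary on t. This local exactness implies
    that Hom(C, L) is exact (local_to_global). Indeed it holds for sufficiently
    many subcomplexes and for the quotients by them; countably many generators can
    be dealt with by correcting successive approximations of a primitive, and
    Zorn's lemma does the rest.

    Conversely, assume that all Gorenstein projective dimensions are at most n. Let
    us call V orthogonal if Hom(C, V) is exact for all totally acyclic complexes C
    of projective modules. Powers of orthogonal modules, kernels of epimorphisms
    and cokernels of monomorphisms between them are orthogonal, and orthogonal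
    modules have projective dimension at most n + 1 (pd_of_absorbed_resolution);
    conversely, modules of finite projective dimension are orthogonal. In view of the uniform bound, Eklof's lemma shows that a module
    with a well-ordered filtration whose subquotients are orthogonal is itself
    orthogonal. It follows that certain reduced powers of a free module L are
    orthogonal (orthogonal_negligible). Now let C be totally acyclic and E the
    character module of L. A cycle of the tensor product of E and C has a value on
    every cochain of C with coefficients in L. This value is zero if the cochain is
    closed on a suitable finite list w (value_finite); otherwise one counterexample
    for each w would provide a cocycle with values in a reduced power which is not
    a coboundary. Since Q/Z is divisible, the cycle is then a boundary, supported
    on w (cofree_boundary). Every injective right module is a direct summand of
    such an E (injective_tensor_exact). *)

Set Implicit Arguments.
Unset Strict Implicit.
Unset Printing Implicit Defensive.

Import GRing.Theory Num.Theory.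

Local Open Scope quotient_scope.
Local Open Scope ring_scope.

(** * Linear algebra over an arbitrary ring *)

Section MapOfRelation.

Lemma additive_of_rel (A B : zmodType) (r : A -> B -> Prop) :
  (forall a, exists b, r a b) ->
  (forall a b a' b', r a b -> r a' b' -> r (a - a') (b - b')) ->
  (forall b, r 0 b -> b = 0) ->
  exists h : {additive A -> B}, forall a, r a (h a).
Proof.
move=> /choice[h rh] rB r0.
have uniq_r a b b' : r a b -> r a b' -> b = b'.
  by move=> rb rb'; apply/subr0_eq/r0; rewrite -(subrr a); apply: rB.
have hB : zmod_morphism h.
  by move=> x y; apply: uniq_r (rh _) _; apply: rB.
pose H := GRing.isZmodMorphism.Build A B h hB.
by exists (HB.pack_for {additive A -> B} h H).
Qed.

Lemma additive_of_fun (A B : zmodType) (f : A -> B) :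
  zmod_morphism f -> exists h : {additive A -> B}, forall a, h a = f a.
Proof.
move=> fB; pose H := GRing.isZmodMorphism.Build A B f fB.
by exists (HB.pack_for {additive A -> B} f H).
Qed.

Variable R : pzRingType.

Lemma linear_of_rel (A B : lmodType R) (r : A -> B -> Prop) :
  (forall a, exists b, r a b) ->
  (forall k a b a' b', r a b -> r a' b' -> r (k *: a + a') (k *: b + b')) ->
  (forall b, r 0 b -> b = 0) ->
  exists h : {linear A -> B}, forall a, r a (h a).
Proof.
move=> /choice[h rh] rD r0.
have uniq_r a b b' : r a b -> r a b' -> b = b'.
  move=> rb rb'; apply/subr0_eq/r0; rewrite -(subrr a) addrC [b - b']addrC.
  by rewrite -!scaleN1r; apply: rD.
have hD : linear h.
  by move=> k x y; apply: uniq_r (rh _) _; apply: rD.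
pose H := GRing.isLinear.Build R A B _ h hD.
by exists (HB.pack_for {linear A -> B} h H).
Qed.

Lemma linear_of_fun (A B : lmodType R) (f : A -> B) :
  linear f -> exists h : {linear A -> B}, forall a, h a = f a.
Proof.
move=> fD; pose H := GRing.isLinear.Build R A B _ f fD.
by exists (HB.pack_for {linear A -> B} f H).
Qed.

End MapOfRelation.

Section Submodules.
Variables (R : pzRingType) (M : lmodType R).
Implicit Type U : M -> Prop.

Definition is_submod U : Prop :=
  U 0 /\ forall a x y, U x -> U y -> U (a *: x + y).

Section SubQuotient.
Variables (U : M -> Prop) (Usub : is_submod U).

Definition submod_pred of is_submod U : {pred M} := fun x => `[< U x >].

Lemma submod_pred_closed : submod_closed (submod_pred Usub).
Proof.
split=> [|a x y /asboolP Ux /asboolP Uy]; first exact/asboolP/Usub.1.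
exact/asboolP/Usub.2.
Qed.

HB.instance Definition _ :=
  GRing.isSubmodClosed.Build R M (submod_pred Usub)
    (GRing.submod_closed_semi submod_pred_closed).

Record submod := Submod { submod_val : M; _ : submod_val \in submod_pred Usub }.

HB.instance Definition _ := [isSub for submod_val].
HB.instance Definition _ := [Choice of submod by <:].
HB.instance Definition _ := [SubChoice_isSubLmodule of submod by <:].

Lemma submodule_of_pred :
  exists (K : lmodType R) (i : {linear K -> M}),
    injective i /\ forall x, U x <-> exists k, i k = x.
Proof.
have [|i iE] := @linear_of_fun R submod M submod_val.
  move=> k x y; rewrite -[submod_val]/(\val) raddfD -[RHS]/(k *: \val x + _).
  by rewrite -(linearZ_LR (\val : {linear submod -> M})).
exists submod, i; split=> [x y|x]; first by rewrite !iE; apply: val_inj.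
split=> [Ux|[[y yU] <-]]; last by rewrite iE; exact/asboolP.
have xU : x \in submod_pred Usub by apply/asboolP.
by exists (Submod xU); rewrite iE.
Qed.

Definition quotmod : Type := Quotient.quot (submod_pred Usub).
HB.instance Definition _ := GRing.Zmodule.on quotmod.

Let pi (x : M) : quotmod := \pi_(Quotient.quot (submod_pred Usub)) x.

Let piD x y : pi (x + y) = pi x + pi y.
Proof. exact: raddfD. Qed.

Let piE x y : U (x - y) <-> pi x = pi y.
Proof.
split=> [Uxy|/eqP]; first by apply/eqP; rewrite -Quotient.idealrBE; apply/asboolP.
by rewrite -Quotient.idealrBE => /asboolP.
Qed.

Definition quot_scale (a : R) (q : quotmod) : quotmod := pi (a *: repr q).

Let pi_repr q : pi (repr q) = q.
Proof. exact: reprK. Qed.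

Let pi_scale a x : quot_scale a (pi x) = pi (a *: x).
Proof.
apply/piE; rewrite -scalerBr -[_ *: _]addr0; apply: Usub.2 Usub.1.
by apply/piE; rewrite pi_repr.
Qed.

Let quot_scalerA a b q : quot_scale a (quot_scale b q) = quot_scale (a * b) q.
Proof. by rewrite -[q]pi_repr !pi_scale scalerA. Qed.

Let quot_scale1r : left_id 1 quot_scale.
Proof. by move=> q; rewrite -[q]pi_repr pi_scale scale1r. Qed.

Let quot_scalerDr : right_distributive quot_scale +%R.
Proof.
by move=> a p q; rewrite -[p]pi_repr -[q]pi_repr -piD !pi_scale scalerDr piD.
Qed.

Let quot_scalerDl q : {morph quot_scale^~ q : a b / a + b}.
Proof. by move=> a b; rewrite -[q]pi_repr !pi_scale scalerDl piD. Qed.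

HB.instance Definition _ := GRing.Zmodule_isLmodule.Build R quotmod
  quot_scalerA quot_scale1r quot_scalerDr quot_scalerDl.

Lemma quotient_by_pred :
  exists (Q : lmodType R) (q : {linear M -> Q}),
    (forall y, exists x, q x = y) /\ forall x, q x = 0 <-> U x.
Proof.
have [|q qE] := @linear_of_fun R M quotmod pi.
  by move=> k x y; rewrite piD -pi_scale.
exists quotmod, q; split=> [y|x]; first by exists (repr y); rewrite qE pi_repr.
rewrite qE -{2}[x]subr0 piE.
by have -> : pi 0 = 0 by apply: raddf0.
Qed.

End SubQuotient.
End Submodules.

Section DirectSum.
Variables (R : pzRingType) (I : eqType) (C : I -> lmodType R).

Definition fin_supp (x : forall i, C i) : Prop :=
  exists s : seq I, forall i, i \notin s -> x i = 0.

Record dsum := Dsum { dsum_fun :> forall i, C i; _ : fin_supp dsum_fun }.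

Lemma dsum_supp (x : dsum) : fin_supp x. Proof. by case: x. Qed.

Lemma dsum_ext (x y : dsum) : (forall i, x i = y i) -> x = y.
Proof.
case: x y => [x xP] [y yP] /= xy.
have {}xy : x = y by apply: functional_extensionality_dep.
by case: y / xy yP => yP; congr Dsum; apply: Prop_irrelevance.
Qed.

HB.instance Definition _ := gen_eqMixin dsum.
HB.instance Definition _ := gen_choiceMixin dsum.

Let zeroP : fin_supp (fun i => 0 : C i). Proof. by exists [::]. Qed.
Let oppP (x : dsum) : fin_supp (fun i => - x i).
Proof. by have [s sx] := dsum_supp x; exists s => i /sx->; rewrite oppr0. Qed.
Let addP (x y : dsum) : fin_supp (fun i => x i + y i).
Proof.
have [[s sx] [t ty]] := (dsum_supp x, dsum_supp y).
exists (s ++ t) => i; rewrite mem_cat negb_or => /andP[/sx-> /ty->].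
exact: addr0.
Qed.
Let scaleP a (x : dsum) : fin_supp (fun i => a *: x i).
Proof. by have [s sx] := dsum_supp x; exists s => i /sx->; rewrite scaler0. Qed.

Let addA : associative (fun x y => Dsum (addP x y)).
Proof. by move=> x y z; apply: dsum_ext => i /=; apply: addrA. Qed.
Let addC : commutative (fun x y => Dsum (addP x y)).
Proof. by move=> x y; apply: dsum_ext => i /=; apply: addrC. Qed.
Let add0 : left_id (Dsum zeroP) (fun x y => Dsum (addP x y)).
Proof. by move=> x; apply: dsum_ext => i /=; apply: add0r. Qed.
Let addN : left_inverse (Dsum zeroP) (fun x => Dsum (oppP x))
  (fun x y => Dsum (addP x y)).
Proof. by move=> x; apply: dsum_ext => i /=; apply: addNr. Qed.

HB.instance Definition _ := GRing.isZmodule.Build dsum addA addC add0 addN.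

Let scaleA a b (x : dsum) :
  Dsum (scaleP a (Dsum (scaleP b x))) = Dsum (scaleP (a * b) x).
Proof. by apply: dsum_ext => i /=; apply: scalerA. Qed.
Let scale1 : left_id 1 (fun a x => Dsum (scaleP a x)).
Proof. by move=> x; apply: dsum_ext => i /=; apply: scale1r. Qed.
Let scaleDr : right_distributive (fun a x => Dsum (scaleP a x)) +%R.
Proof. by move=> a x y; apply: dsum_ext => i /=; apply: scalerDr. Qed.
Let scaleDl (x : dsum) :
  {morph (fun a => Dsum (scaleP a x)) : a b / a + b}.
Proof. by move=> a b; apply: dsum_ext => i /=; apply: scalerDl. Qed.

HB.instance Definition _ := GRing.Zmodule_isLmodule.Build R dsum
  scaleA scale1 scaleDr scaleDl.

Lemma dsum_sumE J (r : seq J) (F : J -> dsum) i :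
  (\sum_(j <- r) F j) i = \sum_(j <- r) F j i.
Proof. by elim/big_rec2: _ => // j y x _ <-. Qed.

Definition din_fun i (c : C i) j : C j :=
  if i =P j is ReflectT e then eq_rect i C c j e else 0.

Lemma din_fun_id i (c : C i) : din_fun c i = c.
Proof. by rewrite /din_fun; case: eqP => // e; rewrite eq_axiomK. Qed.

Lemma din_fun_neq i (c : C i) j : i != j -> din_fun c j = 0.
Proof. by rewrite /din_fun; case: eqP. Qed.

Lemma din_fun_supp i (c : C i) : fin_supp (din_fun c).
Proof.
by exists [:: i] => j; rewrite inE eq_sym => /din_fun_neq->.
Qed.

Definition din i (c : C i) : dsum := Dsum (din_fun_supp c).

Lemma din_is_linear i : linear (@din i).
Proof.
move=> a x y; apply: dsum_ext => j /=.
have [ij|ij] := eqVneq i j; last by rewrite /= !din_fun_neq ?scaler0 ?addr0.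
by case: j / ij; rewrite /= !din_fun_id.
Qed.

HB.instance Definition _ i :=
  GRing.isLinear.Build R (C i) dsum _ (@din i) (@din_is_linear i).

Lemma dinE i (c : C i) : din c i = c. Proof. exact: din_fun_id. Qed.

Lemma din_neq i (c : C i) j : i != j -> din c j = 0.
Proof. exact: din_fun_neq. Qed.

Lemma dsum_decomp (x : dsum) (s : seq I) :
  uniq s -> (forall i, i \notin s -> x i = 0) -> x = \sum_(i <- s) din (x i).
Proof.
move=> s_uniq sx; apply: dsum_ext => j; rewrite dsum_sumE.
have [js|js] := boolP (j \in s); last first.
  rewrite sx // big1_seq // => i /= iS; apply: din_neq.
  by apply: contraNneq js => <-.
rewrite (bigD1_seq j) //= din_fun_id big1 ?addr0 // => i ij.
exact: din_neq.
Qed.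

Lemma dsum_cover (x : dsum) :
  exists2 s : seq I, uniq s & forall i, i \notin s -> x i = 0.
Proof.
have [s sx] := dsum_supp x.
by exists (undup s); rewrite ?undup_uniq // => i; rewrite mem_undup => /sx.
Qed.

Lemma dsum_span (P : dsum -> Prop) :
  P 0 -> (forall x y, P x -> P y -> P (x + y)) ->
  (forall i (c : C i), P (din c)) -> forall x, P x.
Proof.
move=> P0 PD Pin x; have [s s_uniq sx] := dsum_cover x.
by rewrite (dsum_decomp s_uniq sx); apply: big_ind.
Qed.

Section Lift.
Variables (A : zmodType) (h : forall i, {additive C i -> A}).

(** This makes the map defined in dsum_lift_additive single-valued: two lists that
    cover the support of x are contained in a common one. *)
Lemma dsum_lift_sub (x : dsum) (s t : seq I) :
    uniq s -> uniq t -> {subset s <= t} ->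
    (forall i, i \notin s -> x i = 0) ->
  \sum_(i <- s) h i (x i) = \sum_(i <- t) h i (x i).
Proof.
move=> us ut st sx; rewrite [RHS](bigID (mem s)) /= [X in _ + X]big1 ?addr0.
  rewrite -[RHS]big_filter; apply: perm_big; apply: uniq_perm => //.
    exact: filter_uniq.
  by move=> i; rewrite mem_filter /=; case si: (i \in s) => //=; rewrite st.
by move=> i /sx ->; rewrite raddf0.
Qed.

Lemma dsum_lift_additive :
  exists H : {additive dsum -> A}, forall i c, H (din c) = h i c.
Proof.
pose r (x : dsum) y := exists s : seq I,
  [/\ uniq s, forall i, i \notin s -> x i = 0 & y = \sum_(i <- s) h i (x i)].
have [x|x y x' y' [s [us sx ->]] [s' [us' sx' ->]]|y [s [us _ ->]]|H HE] :=
    @additive_of_rel dsum A r.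
- by have [s us sx] := dsum_cover x; exists (\sum_(i <- s) h i (x i)), s.
- pose t := undup (s ++ s').
  have ut : uniq t by apply: undup_uniq.
  have st : {subset s <= t}.
    by move=> i si; rewrite mem_undup mem_cat si.
  have st' : {subset s' <= t}.
    by move=> i si; rewrite mem_undup mem_cat si orbT.
  exists t; split=> // [i it|].
    have xi : x i = 0 by apply: sx; apply: contra it; apply: st.
    have xi' : x' i = 0 by apply: sx'; apply: contra it; apply: st'.
    by rewrite -[(x - x') i]/(x i - x' i) xi xi' subr0.
  rewrite (dsum_lift_sub us ut) // (dsum_lift_sub us' ut) // -sumrB.
  by apply: eq_bigr => i _; rewrite -raddfB.
- by rewrite big1 // => i _; apply: raddf0.
exists H => i c; have [s [us sx ->]] := HE (din c).
have si : {subset s <= undup (i :: s)} by move=> j js; rewrite mem_undup inE js orbT.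
rewrite (dsum_lift_sub us (undup_uniq _) si) //.
rewrite (bigD1_seq i) ?undup_uniq ?mem_undup ?mem_head //=.
rewrite din_fun_id big1 ?addr0 // => j; rewrite eq_sym => /din_fun_neq->.
exact: raddf0.
Qed.

End Lift.

Lemma dsum_lift (A : lmodType R) (h : forall i, {linear C i -> A}) :
  exists H : {linear dsum -> A}, forall i c, H (din c) = h i c.
Proof.
have [H0 H0E] := dsum_lift_additive (fun i => h i : {additive _ -> _}).
have [k x y|H HE] := @linear_of_fun R dsum A H0.
  suff HZ : H0 (k *: x) = k *: H0 x by rewrite raddfD HZ.
  elim/dsum_span: x => [|x x' xZ x'Z|i c]; first by rewrite scaler0 raddf0 scaler0.
    by rewrite scalerDr !raddfD /= xZ x'Z.
  have -> : k *: din c = din (k *: c) by rewrite linearZ.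
  by rewrite !H0E /= linearZ.
by exists H => i c; rewrite HE H0E.
Qed.

End DirectSum.

Lemma dep_choice (I : Type) (T : I -> Type) (P : forall i, T i -> Prop) :
  (forall i, exists x, P i x) -> exists f, forall i, P i (f i).
Proof.
by move=> exP; exists (fun i => sval (cid (exP i))) => i; apply: svalP.
Qed.

Definition free_mod (R : pzRingType) (X : eqType) : lmodType R :=
  dsum (fun _ : X => (R^o : lmodType R)).

Section Free.
Variables (R : pzRingType) (X : eqType).
Local Notation F := (free_mod R X).

Definition gen (x : X) : F := @din R X (fun _ => R^o) x (1 : R^o).

Lemma din_gen x (a : R) : @din R X (fun _ => R^o) x (a : R^o) = a *: gen x.
Proof.
rewrite /gen -linearZ; congr din.
by rewrite -[RHS]/(a * 1) mulr1.
Qed.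

Lemma free_decomp (z : F) (s : seq X) :
  uniq s -> (forall x, x \notin s -> z x = 0) ->
  z = \sum_(x <- s) (z x : R) *: gen x.
Proof.
move=> us /(dsum_decomp us) {1}->.
by apply: eq_bigr => x _; rewrite -din_gen.
Qed.

Lemma free_span (P : F -> Prop) :
  P 0 -> (forall a x y, P x -> P y -> P (a *: x + y)) ->
  (forall x, P (gen x)) -> forall z, P z.
Proof.
move=> P0 PD Pgen; have PZ a z : P z -> P (a *: z).
  by move=> Pz; rewrite -[_ *: _]addr0; apply: PD.
apply: dsum_span => // [x y Px Py|x c]; last by rewrite din_gen; apply: PZ.
by rewrite -[x]scale1r; apply: PD.
Qed.

Lemma free_lift_exists (M : lmodType R) (u : X -> M) :
  exists H : {linear F -> M}, forall x, H (gen x) = u x.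
Proof.
have h x : exists h : {linear R^o -> M}, forall a : R, h a = a *: u x.
  apply: linear_of_fun => a b c.
  by rewrite -[a *: b]/(a * b) scalerDl scalerA.
have [h' h'E] := choice h.
have [H HE] := dsum_lift h'.
by exists H => x; rewrite HE h'E scale1r.
Qed.

Lemma free_ext (M : lmodType R) (f g : {linear F -> M}) :
  (forall x, f (gen x) = g (gen x)) -> forall z, f z = g z.
Proof.
move=> fg; apply: free_span => [|a x y fx fy|//]; first by rewrite !raddf0.
by rewrite !linearP fx fy.
Qed.

Lemma free_projective : projective_module F.
Proof.
move=> A B g f gsurj.
have /choice[u uE] : forall x, exists a, g a = f (gen x) by [].
have [h hE] := free_lift_exists u; exists h.
by move=> z; rewrite -[LHS]/((g \o h) z); apply: free_ext => x; rewrite /= hE.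
Qed.

End Free.

Section Projective.
Variable R : pzRingType.

(** The elements of P and the coordinates of s form a dual basis of P. *)
Lemma projective_section (P : lmodType R) : projective_module P ->
  exists (p : {linear free_mod R P -> P}) (s : {linear P -> free_mod R P}),
    (forall x, p (gen R x) = x) /\ (forall x, p (s x) = x).
Proof.
move=> Pproj; have [p pE] := free_lift_exists (fun x : P => x).
have [y|s sE] := Pproj _ _ p idfun; first by exists (gen R y).
by exists p, s.
Qed.

Lemma projective_sum (I : eqType) (C : I -> lmodType R) :
  (forall i, projective_module (C i)) -> projective_module (dsum C).
Proof.
move=> Cproj A B g f gsurj.
have /dep_choice[h hE] : forall i, exists h : {linear C i -> A},
    forall c, g (h c) = f (din c).
  by move=> i; apply: (Cproj i _ _ g (f \o (@din _ _ C i))).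
have [H HE] := dsum_lift h; exists H.
apply: dsum_span => [|x y gx gy|i c]; first by rewrite !raddf0.
  by rewrite !raddfD /= gx gy.
by rewrite HE hE.
Qed.

Lemma projective_prod (P Q : lmodType R) :
  projective_module P -> projective_module Q ->
  projective_module (P * Q)%type.
Proof.
move=> Pproj Qproj A B g f gsurj.
have [f1 f1E] : exists f1 : {linear P -> B}, forall x, f1 x = f (x, 0).
  apply: linear_of_fun => a x y; rewrite -linearP; congr (f (_, _)).
  by rewrite /= scaler0 addr0.
have [f2 f2E] : exists f2 : {linear Q -> B}, forall x, f2 x = f (0, x).
  apply: linear_of_fun => a x y; rewrite -linearP; congr (f (_, _)).
  by rewrite /= scaler0 addr0.
have [h1 h1E] := Pproj _ _ g f1 gsurj.
have [h2 h2E] := Qproj _ _ g f2 gsurj.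
have [h hE] : exists h : {linear (P * Q)%type -> A},
    forall x, h x = h1 x.1 + h2 x.2.
  apply: linear_of_fun => a x y.
  by rewrite /= !linearP scalerDr addrACA.
exists h => -[x y]; rewrite hE raddfD /= h1E h2E f1E f2E -raddfD.
by congr (f (_, _)); rewrite /= ?addr0 ?add0r.
Qed.

End Projective.

(** * Characters of abelian groups *)

Definition divisible (D : zmodType) : Prop :=
  forall (n : nat) (d : D), exists e, e *+ n.+1 = d.

Lemma int_subgroup (P : int -> Prop) :
  P 0 -> (forall x y, P x -> P y -> P (x - y)) ->
  exists m : nat, forall k, P k <-> exists j, k = j * m%:Z.
Proof.
move=> P0 PB.
have PN x : P x -> P (- x) by rewrite -sub0r; apply: PB.
have PD x y : P x -> P y -> P (x + y).
  by move=> Px Py; rewrite -[y]opprK; apply/PB/PN.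
have PM x j : P x -> P (j * x).
  have PMn n : P x -> P (n%:Z * x).
    move=> Px; elim: n => [|n IHn]; first by rewrite mul0r.
    by rewrite -addn1 PoszD mulrDl mul1r; apply: PD.
  by case: j => n Px; [apply: PMn|rewrite NegzE mulNr; apply/PN/PMn].
have [[n Pn]|noP] := pselect (exists n, P n.+1%:Z); last first.
  exists 0%N => k; split=> [|[j ->]]; last by rewrite mulr0.
  case: k => [[|n]|n] Pk; first by exists 0.
    by case: noP; exists n.
  by case: noP; exists n; move/PN: Pk; rewrite NegzE opprK.
have exn : exists n, `[< P n.+1%:Z >] by exists n; apply/asboolP.
case: (ex_minnP exn) => m /asboolP Pm mmin {n Pn exn}; exists m.+1 => k.
split=> [Pk|[j ->]]; last exact: PM.
exists (k %/ m.+1)%Z; have kE := divz_eq k m.+1.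
have : P (k %% m.+1)%Z.
  rewrite [X in P X](_ : _ = k - (k %/ m.+1)%Z * m.+1%:Z); last first.
    by rewrite {2}kE addrAC subrr add0r.
  by apply: PB => //; apply: PM.
have := ltz_mod k (isT : m.+1%:Z != 0); have := modz_ge0 k (isT : m.+1%:Z != 0).
case: (k %% m.+1)%Z kE => // -[|r] kE _ rm Pr; first by rewrite {1}kE addr0.
move: rm; rewrite gtr0_norm // ltz_nat ltnS => rm.
by move/asboolP: Pr => /mmin; rewrite leqNgt rm.
Qed.

Section DivisibleExtension.
Variables (D : zmodType) (Ddiv : divisible D) (B : zmodType).

Record partial_char := PartialChar {
  pc_dom : B -> Prop;
  pc_val : B -> D;
  pc_dom0 : pc_dom 0;
  pc_domB : forall x y, pc_dom x -> pc_dom y -> pc_dom (x - y);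
  pc_valB : forall x y, pc_dom x -> pc_dom y ->
    pc_val (x - y) = pc_val x - pc_val y }.

Implicit Types c : partial_char.

Definition pc_le c c' : bool :=
  `[< forall x, pc_dom c x -> pc_dom c' x /\ pc_val c' x = pc_val c x >].

Lemma pc_val0 c : pc_val c 0 = 0.
Proof. by rewrite -(subrr 0) pc_valB ?subrr //; apply: pc_dom0. Qed.

Lemma pc_domN c x : pc_dom c x -> pc_dom c (- x).
Proof. by rewrite -sub0r; apply: pc_domB; apply: pc_dom0. Qed.

Lemma pc_valN c x : pc_dom c x -> pc_val c (- x) = - pc_val c x.
Proof.
by move=> cx; rewrite -sub0r pc_valB ?pc_val0 ?sub0r //; apply: pc_dom0.
Qed.

Lemma pc_domD c x y : pc_dom c x -> pc_dom c y -> pc_dom c (x + y).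
Proof. by move=> cx cy; rewrite -[y]opprK; apply/pc_domB/pc_domN. Qed.

Lemma pc_valD c x y : pc_dom c x -> pc_dom c y ->
  pc_val c (x + y) = pc_val c x + pc_val c y.
Proof.
move=> cx cy; rewrite -{1}[y]opprK pc_valB ?pc_valN ?opprK //.
exact: pc_domN.
Qed.

Lemma pc_domMz c x k : pc_dom c x -> pc_dom c (x *~ k).
Proof.
have domMn n y : pc_dom c y -> pc_dom c (y *+ n).
  move=> cy; elim: n => [|n IHn]; first exact: pc_dom0.
  by rewrite mulrS; apply: pc_domD.
by case: k => n cx; [apply: domMn|apply/pc_domN/domMn].
Qed.

Lemma pc_valMz c x k : pc_dom c x -> pc_val c (x *~ k) = pc_val c x *~ k.
Proof.
move=> cx; have valMn n : pc_val c (x *+ n) = pc_val c x *+ n.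
  elim: n => [|n IHn]; first exact: pc_val0.
  by rewrite !mulrS pc_valD ?IHn //; apply: (@pc_domMz _ _ n).
case: k => n; first exact: valMn.
rewrite NegzE !mulrNz pc_valN; first by rewrite [X in - X]valMn.
exact: pc_domMz.
Qed.

(** The multiples of b that already have a value are the multiples of one of
    them; dividing its value in D gives d. *)
Lemma pc_new_value c b :
  exists d, forall k : int, pc_dom c (b *~ k) -> pc_val c (b *~ k) = d *~ k.
Proof.
have [||[|m] mE] := @int_subgroup (fun k => pc_dom c (b *~ k)).
- by rewrite mulr0z; apply: pc_dom0.
- by move=> x y bx cy; rewrite mulrzBr; apply: pc_domB.
- by exists 0 => k /mE[j ->]; rewrite mulr0 !mulr0z pc_val0.
have bm : pc_dom c (b *~ m.+1) by apply/mE; exists 1; rewrite mul1r.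
have [d dE] := Ddiv m (pc_val c (b *~ m.+1)).
exists d => k /mE[j ->]; rewrite mulrC !mulrzA pc_valMz //.
by congr (_ *~ _); apply: esym dE.
Qed.

Lemma pc_extend c b :
  exists2 c', pc_le c c' & pc_dom c' b.
Proof.
have [d dE] := pc_new_value c b.
have wd h k h' k' : pc_dom c h -> pc_dom c h' -> h + b *~ k = h' + b *~ k' ->
    pc_val c h + d *~ k = pc_val c h' + d *~ k'.
  move=> ch ch' hh.
  have e : b *~ (k - k') = h' - h.
    rewrite mulrzBr; apply/eqP; rewrite subr_eq addrAC.
    by rewrite -hh addrAC subrr add0r.
  have: pc_val c (b *~ (k - k')) = d *~ (k - k').
    by apply: dE; rewrite e; apply: pc_domB.
  rewrite e pc_valB // mulrzBr => /eqP; rewrite subr_eq addrAC => /eqP->.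
  by rewrite subrK addrC.
have /choice[v vE] : forall y, exists z, forall h k, pc_dom c h ->
    y = h + b *~ k -> z = pc_val c h + d *~ k.
  move=> y.
  have [[h [k [ch yE]]]|no] :=
    pselect (exists h k, pc_dom c h /\ y = h + b *~ k).
    by exists (pc_val c h + d *~ k) => h' k' ch' e; apply: wd => //; rewrite -yE.
  by exists 0 => h k ch e; case: no; exists h, k.
have dom0 : exists h k, pc_dom c h /\ 0 = h + b *~ k.
  by exists 0, 0; rewrite mulr0z addr0; split=> //; apply: pc_dom0.
have domB x y : (exists h k, pc_dom c h /\ x = h + b *~ k) ->
    (exists h k, pc_dom c h /\ y = h + b *~ k) ->
    exists h k, pc_dom c h /\ x - y = h + b *~ k.
  move=> [h [k [ch ->]]] [h' [k' [ch' ->]]]; exists (h - h'), (k - k').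
  by split; [apply: pc_domB|rewrite opprD mulrzBr addrACA].
have valB x y : (exists h k, pc_dom c h /\ x = h + b *~ k) ->
    (exists h k, pc_dom c h /\ y = h + b *~ k) -> v (x - y) = v x - v y.
  move=> [h [k [ch xE]]] [h' [k' [ch' yE]]].
  rewrite (vE x h k) // (vE y h' k') // (vE _ (h - h') (k - k')).
  - by rewrite pc_valB // mulrzBr opprD addrACA.
  - exact: pc_domB.
  - by rewrite xE yE opprD mulrzBr addrACA.
exists (PartialChar dom0 domB valB).
  apply/asboolP => x cx /=; split; last first.
    by rewrite (vE x x 0) ?mulr0z ?addr0.
  by exists x, 0; rewrite mulr0z addr0.
by exists 0, 1; rewrite mulr1z add0r; split=> //; apply: pc_dom0.
Qed.

Lemma pc_chain (Ch : set partial_char) c0 : Ch c0 -> total_on Ch pc_le ->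
  exists c', forall c, Ch c -> pc_le c c'.
Proof.
move=> Ch0 tot.
pose dom x := exists2 c, Ch c & pc_dom c x.
have coh c c' x : Ch c -> Ch c' -> pc_dom c x -> pc_dom c' x ->
    pc_val c x = pc_val c' x.
  move=> Cc Cc' cx cx'.
  by have [/asboolP/(_ x cx)[]|/asboolP/(_ x cx')[]] := tot _ _ Cc Cc'.
have common x y : dom x -> dom y ->
    exists c, [/\ Ch c, pc_dom c x & pc_dom c y].
  move=> [c Cc cx] [c' Cc' cy].
  have [/asboolP/(_ x cx)[]|/asboolP/(_ y cy)[]] := tot _ _ Cc Cc'.
    by exists c'.
  by exists c.
have /choice[v vE] : forall x, exists z, forall c, Ch c -> pc_dom c x ->
    z = pc_val c x.
  move=> x; have [[c Cc cx]|no] := pselect (dom x); last first.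
    by exists 0 => c Cc cx; case: no; exists c.
  by exists (pc_val c x) => c' Cc' cx'; apply: coh.
have dom0 : dom 0 by exists c0 => //; apply: pc_dom0.
have domB x y : dom x -> dom y -> dom (x - y).
  move=> dx dy; have [c [Cc cx cy]] := common _ _ dx dy.
  by exists c => //; apply: pc_domB.
have valB x y : dom x -> dom y -> v (x - y) = v x - v y.
  move=> dx dy; have [c [Cc cx cy]] := common _ _ dx dy.
  by rewrite !(vE _ c) ?pc_valB //; apply: pc_domB.
exists (PartialChar dom0 domB valB) => c Cc; apply/asboolP => x cx /=.
by split; [exists c|apply: vE].
Qed.

Lemma pc_total c :
  exists h : {additive B -> D}, forall x, pc_dom c x -> h x = pc_val c x.
Proof.
pose T := {c' : partial_char | pc_le c c'}.
have le_refl c' : pc_le c' c' by apply/asboolP.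
have le_trans c2 c1 c3 : pc_le c1 c2 -> pc_le c2 c3 -> pc_le c1 c3.
  move=> /asboolP le12 /asboolP le23; apply/asboolP => x /le12[x2 <-].
  exact: le23.
have [||Ch tot|[m cm] mmax] :=
    @ZL_preorder T (exist _ c (le_refl c)) (fun a b => pc_le (sval a) (sval b)).
- by move=> t; apply: le_refl.
- by move=> r s t; apply: le_trans.
- have [[t1 Ch1]|no] := pselect (exists t, Ch t); last first.
    exists (exist _ c (le_refl c)) => s Cs.
    by case: no; exists s.
  have [||c' c'ub] := @pc_chain [set x | exists2 s, Ch s & sval s = x] (sval t1).
  + by exists t1.
  + by move=> _ _ [s Cs <-] [s' Cs' <-]; apply: tot.
  have cc' : pc_le c c' by apply: le_trans (svalP t1) (c'ub _ _); exists t1.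
  by exists (exist _ c' cc') => s Cs; apply: c'ub; exists s.
have mtot b : pc_dom m b.
  have [c' mc' c'b] := pc_extend m b.
  have /= /asboolP le' := mmax (exist _ c' (le_trans _ _ _ cm mc')) mc'.
  by have [] := le' _ c'b.
have vB : zmod_morphism (pc_val m) by move=> x y; apply: pc_valB.
pose H := GRing.isZmodMorphism.Build B D (pc_val m) vB.
exists (HB.pack_for {additive B -> D} (pc_val m) H) => x cx.
by have /asboolP/(_ x cx)[] := cm.
Qed.

End DivisibleExtension.

(** Injectivity of divisible groups. The partial homomorphism is given by its
    graph, since in the applications it is defined by a formula in parameters
    that its argument does not determine. *)
Lemma divisible_extend (D A : zmodType) (r : A -> D -> Prop) :
  divisible D -> r 0 0 ->
  (forall a b a' b', r a b -> r a' b' -> r (a - a') (b - b')) ->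
  (forall b, r 0 b -> b = 0) ->
  exists h : {additive A -> D}, forall a b, r a b -> h a = b.
Proof.
move=> Ddiv r0 rB r_uniq0.
have r_uniq a b b' : r a b -> r a b' -> b = b'.
  by move=> rb rb'; apply/subr0_eq/r_uniq0; rewrite -(subrr a); apply: rB.
have /choice[v vE] : forall a, exists b, forall b', r a b' -> b = b'.
  move=> a; have [[b rb]|no] := pselect (exists b, r a b).
    by exists b => b'; apply: r_uniq.
  by exists 0 => b rb; case: no; exists b.
have dom0 : exists b, r 0 b by exists 0.
have domB x y : (exists b, r x b) -> (exists b, r y b) -> exists b, r (x - y) b.
  by move=> [b rb] [b' rb']; exists (b - b'); apply: rB.
have valB x y : (exists b, r x b) -> (exists b, r y b) -> v (x - y) = v x - v y.
  move=> [b rb] [b' rb']; rewrite (vE _ _ rb) (vE _ _ rb').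
  exact/vE/rB.
have [h hE] := pc_total Ddiv (PartialChar dom0 domB valB).
by exists h => a b rb; rewrite hE; [apply: vE|exists b].
Qed.

Definition rat_integer : {pred rat} := fun x => x \is a Num.int.

Lemma rat_integer_closed : zmod_closed rat_integer.
Proof. by split=> [|x y xZ yZ]; [apply: rpred0|apply: rpredB]. Qed.

HB.instance Definition _ := GRing.isZmodClosed.Build rat rat_integer
  rat_integer_closed.

Definition rational_circle : zmodType := Quotient.quot rat_integer.

Lemma rational_circle_pi0 (x : rat) :
  (\pi_rational_circle x = 0) <-> x \is a Num.int.
Proof.
rewrite -[0](raddf0 \pi_rational_circle) -{2}[x]subr0.
by split=> [/eqP|xZ]; [|apply/eqP]; rewrite -Quotient.idealrBE.
Qed.

Lemma rational_circle_divisible : divisible rational_circle.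
Proof.
move=> n d; exists (\pi_rational_circle (repr d / n.+1%:R)).
have n0 : n.+1%:R != 0 :> rat by rewrite pnatr_eq0.
by rewrite -raddfMn -[(_ / _) *+ _]mulr_natr divfK //; apply: reprK.
Qed.

(** The character sends a to 1/m if a has order m, and to 1/2 if its order is
    infinite. *)
Lemma character_neq0 (A : zmodType) (a : A) : a != 0 ->
  exists h : {additive A -> rational_circle}, h a != 0.
Proof.
move=> a0; have [||m mE] := @int_subgroup (fun k => a *~ k = 0).
- exact: mulr0z.
- by move=> x y ax ay; rewrite mulrzBr ax ay subrr.
have [d d0 dm] : exists2 d : rational_circle, d != 0 & d *~ m = 0.
  pose m' := if m is 0%N then 2%N else m.
  have m'1 : (1 < m')%N.
    rewrite /m'; case: m mE {m'} => [|[|//]] // mE.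
    by case/eqP: a0; rewrite -[a]mulr1z; apply/mE; exists 1.
  exists (\pi_rational_circle m'%:R^-1).
    apply/eqP => /rational_circle_pi0/intrP[j jE].
    have := congr1 ( *%R m'%:R) jE.
    have m'0 : m'%:R != 0 :> rat by rewrite pnatr_eq0; case: m' m'1 {jE}.
    rewrite divff //.
    rewrite -[m'%:R]/(m'%:Z%:~R) -intrM -[1]/(1%:~R) => /eqP.
    rewrite eqr_int => /eqP/(congr1 absz); rewrite abszM /= => /esym/eqP.
    by rewrite muln_eq1 => /andP[/eqP m'E _]; rewrite m'E in m'1.
  rewrite /m'; case: m {mE m' m'1} => [|m]; first exact: mulr0z.
  rewrite -raddfMz; apply/rational_circle_pi0.
  have m0 : m.+1%:R != 0 :> rat by rewrite pnatr_eq0.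
  by rewrite -mulrzr mulVf // rpred1.
have dE k k' : a *~ k = a *~ k' -> d *~ k = d *~ k'.
  move=> /eqP; rewrite -subr_eq0 -mulrzBr => /eqP/mE[j kj].
  by apply/eqP; rewrite -subr_eq0 -mulrzBr kj mulrC mulrzA dm mul0rz.
have [|||h hE] := @divisible_extend rational_circle A
  (fun y z => exists k, y = a *~ k /\ z = d *~ k) rational_circle_divisible.
- by exists 0; rewrite !mulr0z.
- move=> _ _ _ _ [k [-> ->]] [k' [-> ->]]; exists (k - k').
  by rewrite !mulrzBr.
- by move=> _ [k [ak ->]]; rewrite -(mulr0z d); apply/dE; rewrite -ak mulr0z.
by exists h; rewrite (hE a d) //; exists 1; rewrite !mulr1z.
Qed.

Section SubgroupSeparation.
Variables (A : zmodType) (U : A -> Prop).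
Hypotheses (U0 : U 0) (UB : forall x y, U x -> U y -> U (x - y)).

Definition subgroup_pred of U 0 & (forall x y, U x -> U y -> U (x - y)) :
  {pred A} := fun x => `[< U x >].

Lemma subgroup_pred_closed : zmod_closed (subgroup_pred U0 UB).
Proof.
split=> [|x y /asboolP Ux /asboolP Uy]; first exact/asboolP.
exact/asboolP/UB.
Qed.

HB.instance Definition _ := GRing.isZmodClosed.Build A (subgroup_pred U0 UB)
  subgroup_pred_closed.

Lemma character_separates a : ~ U a ->
  exists2 h : {additive A -> rational_circle},
    (forall x, U x -> h x = 0) & h a != 0.
Proof.
move=> Ua; pose Q : zmodType := Quotient.quot (subgroup_pred U0 UB).
have pi0 x : (\pi_Q x = 0) <-> U x.
  rewrite -[0](raddf0 \pi_Q) -{2}[x]subr0.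
  split=> [/eqP|Ux]; [|apply/eqP]; rewrite -Quotient.idealrBE.
    by move/asboolP.
  exact/asboolP.
have [|h h0] := @character_neq0 Q (\pi_Q a); first by apply/eqP => /pi0.
by exists (h \o \pi_Q) => //= x /pi0->; rewrite raddf0.
Qed.

End SubgroupSeparation.

(** ** Injective modules *)

Section Coinduced.
Variable S : pzRingType.
Local Notation QZ := rational_circle.

(** The additive maps from S to Q/Z, with the action of S by right translation
    of the argument: the character module of S as a right module. *)
Record coind := Coind { coind_fun :> S -> QZ; _ : zmod_morphism coind_fun }.

Lemma coindB (f : coind) : zmod_morphism f. Proof. by case: f. Qed.

HB.instance Definition _ (f : coind) :=
  GRing.isZmodMorphism.Build S QZ f (coindB f).

Lemma coind_ext (f g : coind) : (forall r, f r = g r) -> f = g.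
Proof.
case: f g => [f fP] [g gP] /= fg.
have {}fg : f = g by apply: funext.
by case: g / fg gP => gP; congr Coind; apply: Prop_irrelevance.
Qed.

HB.instance Definition _ := gen_eqMixin coind.
HB.instance Definition _ := gen_choiceMixin coind.

Let zeroP : zmod_morphism (fun _ : S => 0 : QZ).
Proof. by move=> r s; rewrite subrr. Qed.
Let oppP (f : coind) : zmod_morphism (fun r => - f r).
Proof. by move=> r s; rewrite raddfB opprB opprK addrC. Qed.
Let addP (f g : coind) : zmod_morphism (fun r => f r + g r).
Proof. by move=> r s; rewrite !raddfB addrACA opprD. Qed.
Let scaleP a (f : coind) : zmod_morphism (fun r => f (r * a)).
Proof. by move=> r s; rewrite mulrBl raddfB. Qed.

Let addA : associative (fun f g => Coind (addP f g)).
Proof. by move=> f g h; apply: coind_ext => r /=; apply: addrA. Qed.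
Let addC : commutative (fun f g => Coind (addP f g)).
Proof. by move=> f g; apply: coind_ext => r /=; apply: addrC. Qed.
Let add0 : left_id (Coind zeroP) (fun f g => Coind (addP f g)).
Proof. by move=> f; apply: coind_ext => r /=; apply: add0r. Qed.
Let addN : left_inverse (Coind zeroP) (fun f => Coind (oppP f))
  (fun f g => Coind (addP f g)).
Proof. by move=> f; apply: coind_ext => r /=; apply: addNr. Qed.

HB.instance Definition _ := GRing.isZmodule.Build coind addA addC add0 addN.

Let scaleA a b (f : coind) :
  Coind (scaleP a (Coind (scaleP b f))) = Coind (scaleP (a * b) f).
Proof. by apply: coind_ext => r /=; rewrite mulrA. Qed.
Let scale1 : left_id 1 (fun a f => Coind (scaleP a f)).
Proof. by move=> f; apply: coind_ext => r /=; rewrite mulr1. Qed.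
Let scaleDr : right_distributive (fun a f => Coind (scaleP a f)) +%R.
Proof. by move=> a f g; apply: coind_ext. Qed.
Let scaleDl (f : coind) : {morph (fun a => Coind (scaleP a f)) : a b / a + b}.
Proof. by move=> a b; apply: coind_ext => r /=; rewrite mulrDr raddfD. Qed.

HB.instance Definition _ := GRing.Zmodule_isLmodule.Build S coind
  scaleA scale1 scaleDr scaleDl.

Definition cofree (Y : Type) : lmodType S := (Y -> coind).

Lemma cofreeE Y a (f g : cofree Y) y r :
  (a *: f + g) y r = f y (r * a) + g y r.
Proof. by []. Qed.

Lemma linear_into_cofree (M : lmodType S) Y (b : Y -> {additive M -> QZ}) :
  exists h : {linear M -> cofree Y}, forall m y r, h m y r = b y (r *: m).
Proof.
have bP m y : zmod_morphism (fun r : S => b y (r *: m)).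
  by move=> r s; rewrite scalerBl raddfB.
have [|h hE] := @linear_of_fun S M (cofree Y) (fun m y => Coind (bP m y)).
  move=> a m m'; apply: funext => y; apply: coind_ext => r.
  by rewrite cofreeE /= scalerDr raddfD scalerA.
by exists h => m y r; rewrite hE.
Qed.

(** A homomorphism into cofree Y is determined by its values at the unit of S,
    a family of characters; these extend. *)
Lemma cofree_injective Y : injective_module (cofree Y).
Proof.
move=> A B g f ginj.
have /choice[b bE] : forall y, exists b : {additive B -> QZ},
    forall a, b (g a) = f a y 1.
  move=> y.
  have [|||h hE] := @divisible_extend QZ B
    (fun x z => exists a, x = g a /\ z = f a y 1) rational_circle_divisible.
  - by exists 0; rewrite !raddf0.
  - move=> _ _ _ _ [a [-> ->]] [a' [-> ->]]; exists (a - a').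
    by rewrite !raddfB.
  - move=> _ [a [ga ->]]; rewrite [a](_ : _ = 0) ?raddf0 //.
    by apply: ginj; rewrite -ga raddf0.
  by exists h => a; apply: hE; exists a.
have [h hE] := linear_into_cofree b; exists h => a.
apply: funext => y; apply: coind_ext => r.
by rewrite hE -linearZ bE linearZ -[LHS]/(f a y (1 * r)) mul1r.
Qed.

(** The coordinates are indexed by the characters of M, which separate its
    elements. *)
Lemma cofree_embedding (M : lmodType S) :
  exists (Y : eqType) (i : {linear M -> cofree Y}), injective i.
Proof.
have [i iE] := linear_into_cofree (fun h : {classic {additive M -> QZ}} => h).
exists {classic {additive M -> QZ}}, i => x y ixy.
apply/eqP/negP => /negP; rewrite -subr_eq0.
move=> /character_neq0[h /negP[]]; rewrite raddfB subr_eq0; apply/eqP.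
by rewrite -[x]scale1r -[y]scale1r -!iE ixy.
Qed.

End Coinduced.

(** * From local to global exactness *)

(** M is a differential module, the cochains are the homomorphisms to L, and s
    gives the coordinates of M with respect to the generators b x. *)
Section LocalToGlobal.
Variables (R : pzRingType) (X : eqType) (M L : lmodType R).
Variables (p : {linear free_mod R X -> M}) (s : {linear M -> free_mod R X}).
Hypothesis ps : forall m, p (s m) = m.
Variable d : {linear M -> M}.
Hypothesis dd : forall m, d (d m) = 0.

Local Notation b x := (p (gen R x)).
Implicit Types (S T : X -> Prop) (m : M) (z : free_mod R X).
Implicit Types f g h q : {linear M -> L}.

Definition supported S m : Prop := forall x, ~ S x -> s m x = 0.

Lemma supported0 S : supported S 0.
Proof. by move=> x _; rewrite raddf0. Qed.

Lemma supported_lin S a m m' :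
  supported S m -> supported S m' -> supported S (a *: m + m').
Proof.
move=> mS m'S x Sx; rewrite linearP -[LHS]/(a *: s m x + s m' x).
by rewrite mS // m'S // scaler0 addr0.
Qed.

Lemma supported_sub S T m :
  (forall x, S x -> T x) -> supported S m -> supported T m.
Proof. by move=> ST mS x Tx; apply: mS => /ST. Qed.

Lemma supported_finite m : exists r : seq X, supported (fun x => x \in r) m.
Proof.
by have [r rm] := dsum_supp (s m); exists r => x /negP xr; apply: rm.
Qed.

Lemma free_span_on S (P : free_mod R X -> Prop) :
  P 0 -> (forall a z z', P z -> P z' -> P (a *: z + z')) ->
  (forall x, S x -> P (gen R x)) ->
  forall z, (forall x, ~ S x -> z x = 0) -> P z.
Proof.
move=> P0 PD Pg z zS; have [r r_uniq rz] := dsum_cover z.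
rewrite (free_decomp r_uniq rz).
have PZ a y : P y -> P (a *: y).
  by move=> Py; rewrite -[_ *: _]addr0; apply: PD.
apply: big_ind => [//|y y' Py Py'|x _]; first by rewrite -[y]scale1r; apply: PD.
have [Sx|Sx] := pselect (S x); first exact/PZ/Pg.
by rewrite zS // scale0r.
Qed.

Lemma supported_span S (P : M -> Prop) :
  P 0 -> (forall a m m', P m -> P m' -> P (a *: m + m')) ->
  (forall x, S x -> P (b x)) -> forall m, supported S m -> P m.
Proof.
move=> P0 PD Pb m mS; rewrite -(ps m).
apply: (free_span_on (S := S) (P := fun z => P (p z))) => //.
  by rewrite raddf0.
by move=> a z z' Pz Pz'; rewrite linearP; apply: PD.
Qed.

Lemma supported_ext S f g : (forall x, S x -> f (b x) = g (b x)) ->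
  forall m, supported S m -> f m = g m.
Proof.
move=> fg; apply: (supported_span (P := fun m => f m = g m)) => // [|a n n' fn fn'].
  by rewrite !raddf0.
by rewrite !linearP fn fn'.
Qed.

(** The elements supported in a stable set S form a subcomplex that is a direct
    summand of M, see stable_d and cutoff. *)
Definition stable S : Prop :=
  forall x, S x -> supported S (b x) /\ supported S (d (b x)).

Lemma stable_img S z : stable S -> (forall x, ~ S x -> z x = 0) ->
  supported S (p z).
Proof.
move=> Sst; apply: (free_span_on (P := fun z => supported S (p z)))
  => [|a y y' Sy Sy'|x /Sst[]//].
  by rewrite raddf0; apply: supported0.
by rewrite linearP; apply: supported_lin.
Qed.

Lemma stable_d S m : stable S -> supported S m -> supported S (d m).
Proof.
move=> Sst; apply: (supported_span (P := fun m => supported S (d m)))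
  => [|a n n' Sn Sn'|x /Sst[]//].
  by rewrite raddf0; apply: supported0.
by rewrite linearP; apply: supported_lin.
Qed.

Lemma cutoff S : stable S -> exists c : {linear M -> M},
  (forall m, supported S (c m)) /\ (forall m, supported S m -> c m = m).
Proof.
move=> Sst.
have [r rE] := free_lift_exists (fun x : X => if `[< S x >] then gen R x else 0).
have rS z : forall x, ~ S x -> r z x = 0.
  elim/free_span: z => [|a y z yS zS|y] x Sx; first by rewrite raddf0.
    rewrite linearP -[LHS]/(a *: r y x + r z x).
    by rewrite yS // zS // scaler0 addr0.
  rewrite rE; case: asboolP => // Sy.
  by apply: din_neq; apply/eqP => yx; apply: Sx; rewrite -yx.
exists (p \o r \o s); split=> m /=; first exact: stable_img Sst (rS _).
move=> mS; rewrite -[RHS]ps; congr (p _).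
apply: (free_span_on (S := S) (P := fun z => r z = z)) => //.
- exact: raddf0.
- by move=> a y z yE zE; rewrite linearP yE zE.
- by move=> x Sx; rewrite rE; case: asboolP.
Qed.

Definition vanishing S f : Prop := forall m, supported S m -> f m = 0.

Definition lifts (w v : seq M) : Prop :=
  forall h, (forall y, y \in w -> h (d y) = 0) ->
  exists q, forall x, x \in v -> h x = q (d x).

(** The analogue of lifts for the quotient of M by the elements supported in S. *)
Definition rel_lifts S (w v : seq M) : Prop :=
  forall h, vanishing S h -> (forall y, y \in w -> h (d y) = 0) ->
  exists2 q, vanishing S q & forall x, x \in v -> h x = q (d x).

Definition all_supported S (v : seq M) : Prop :=
  forall y, y \in v -> supported S y.

(** Local exactness of the subcomplex of S. Exactness of this subcomplex would be
    too much to ask for: when R is uncountable, it cannot be achieved in general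
    by adjoining countably many generators. *)
Definition good S : Prop :=
  stable S /\
  forall v, all_supported S v -> exists2 w, all_supported S w & lifts w v.

(** A primitive h of f need not vanish on the subcomplex of S. There, h is closed
    on any prescribed finite list, hence it is a coboundary on the finitely many
    S-parts of the differentials in question; once this coboundary is subtracted,
    h can be cut off on S. *)
Lemma good_quotient S : good S -> (forall v, exists w, lifts w v) ->
  forall v, exists w, rel_lifts S w v.
Proof.
move=> [Sst Sloc] loc v; have [c [cS cid]] := cutoff Sst.
have [|w1 w1S w1l] := Sloc [seq c (d x) | x <- v].
  by move=> _ /mapP[x _ ->].
have [w wl] := loc (v ++ w1); exists w => f fS fw.
have [h hE] := wl f fw.
have [|q qE] := w1l h.
  by move=> y yw; rewrite -hE ?fS ?mem_cat ?yw ?orbT //; apply: w1S.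
have [g gE] : exists g, forall m, g m = (h (m - c m) - q (d (m - c m))).
  exists ((h \- (q \o d)) \o (idfun \- c)) => m /=.
  by rewrite /= !raddfB.
exists g => [m mS|x xv]; first by rewrite gE cid // subrr !raddf0 addr0.
rewrite gE (linearB h) (linearB d) dd sub0r raddfN opprK /=.
rewrite hE ?mem_cat ?xv // (qE (c (d x))) ?subrK //.
by apply/mapP; exists x.
Qed.

(** Extensions of locally exact complexes are locally exact: a cochain is first
    trivialized on the finitely many S-parts involved, then cut off on S. *)
Lemma good_extension S T : good S -> stable T -> (forall x, S x -> T x) ->
  (forall v, all_supported T v ->
     exists2 w, all_supported T w & rel_lifts S w v) ->
  good T.
Proof.
move=> [Sst Sloc] Tst ST Tloc; split=> // v vT.
have [c [cS cid]] := cutoff Sst.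
have [w2 w2T w2l] := Tloc v vT.
have [|w1 w1S w1l] := Sloc ([seq c (d y) | y <- w2] ++ [seq c x | x <- v]).
  by move=> y; rewrite mem_cat => /orP[] /mapP[x _ ->].
exists (w1 ++ w2).
  move=> y; rewrite mem_cat => /orP[/w1S|/w2T//].
  exact: supported_sub.
move=> h hw.
have [|q1 q1E] := w1l h; first by move=> y yw; apply: hw; rewrite mem_cat yw.
have [g gE] : exists g, forall m, g m = (h (m - c m) - q1 (d (m - c m))).
  by exists ((h \- (q1 \o d)) \o (idfun \- c)) => m /=; rewrite !raddfB.
have [m mS|y yw|q2 q2S q2E] := w2l g.
- by rewrite gE cid // subrr !raddf0 addr0.
- rewrite gE (linearB h) (linearB d) dd sub0r raddfN opprK hw ?mem_cat ?yw ?orbT //.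
  rewrite sub0r q1E ?addNr // mem_cat; apply/orP; left; apply/mapP.
  by exists y.
exists (q1 \+ q2) => x xv /=.
rewrite -q2E // gE (linearB h) (linearB d) (linearB q1) (q1E (c x)).
  by rewrite opprB subrKA addrC subrK.
by rewrite mem_cat; apply/orP; right; apply/mapP; exists x.
Qed.

(** T is obtained from S by adjoining the union of an increasing sequence of finite
    sets K k. On K k.+1, local exactness of the quotient provides a primitive q k
    of f; these are made to converge, as in the Mittag-Leffler argument. *)
Lemma good_step S x0 f : good S -> (forall v, exists w, lifts w v) ->
    vanishing S f -> (forall m, f (d m) = 0) ->
  exists T, [/\ good T, forall x, S x -> T x, T x0 &
    exists2 H : {linear free_mod R X -> L}, forall x, S x -> H (gen R x) = 0 &
      forall x, T x -> f (b x) = H (s (d (b x)))].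
Proof.
move=> Sgood loc fS fd; have Sst := Sgood.1.
have /choice[tau tauP] := good_quotient Sgood loc.
have /choice[sig sigP] := supported_finite.
pose nextK (K : seq X) := K ++ flatten [seq sig (b x) ++ sig (d (b x)) | x <- K]
   ++ flatten [seq sig y | y <- tau [seq b x | x <- K]].
pose K k := iter k nextK [:: x0].
have KS k x : x \in K k -> x \in K k.+1 by rewrite /= mem_cat => ->.
have Kmono k j x : (k <= j)%N -> x \in K k -> x \in K j.
  by move=> /subnK <-; elim: (j - k)%N => // i IHi /IHi/KS.
have Kb k x : x \in K k -> supported (fun y => y \in K k.+1) (b x).
  move=> xK; apply: supported_sub (sigP _) => y yx.
  rewrite /= !mem_cat; apply/orP; right; apply/orP; left.
  by apply/flatten_mapP; exists x => //; rewrite mem_cat yx.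
have Kd k x : x \in K k -> supported (fun y => y \in K k.+1) (d (b x)).
  move=> xK; apply: supported_sub (sigP _) => y yx.
  rewrite /= !mem_cat; apply/orP; right; apply/orP; left.
  by apply/flatten_mapP; exists x => //; rewrite mem_cat yx orbT.
have Ktau k m : m \in tau [seq b x | x <- K k] ->
    supported (fun y => y \in K k.+1) m.
  move=> mt; apply: supported_sub (sigP _) => y ym.
  rewrite /= !mem_cat; apply/orP; right; apply/orP; right.
  by apply/flatten_mapP; exists m.
pose T x := S x \/ exists k, x \in K k.
have ST x : S x -> T x by left.
have KT k x : x \in K k -> T x by move=> xK; right; exists k.
have Tst : stable T.
  move=> x [/Sst[bS dS]|[k xK]]; first by split; apply: supported_sub ST _.
  by split; apply: supported_sub (@KT k.+1) _; [apply: Kb|apply: Kd].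
(* Modulo S, an element supported in T is in the span of some K k. *)
have Tspan m : supported T m -> exists k, forall g q,
    vanishing S g -> vanishing S q ->
    (forall x, x \in K k -> g (b x) = q (d (b x))) -> g m = q (d m).
  apply: (supported_span (P := fun m => exists k, forall g q,
    vanishing S g -> vanishing S q ->
    (forall x, x \in K k -> g (b x) = q (d (b x))) -> g m = q (d m))).
  - by exists 0%N => g q _ _ _; rewrite !raddf0.
  - move=> a m1 m2 [k1 E1] [k2 E2]; exists (maxn k1 k2) => g q gS qS gq.
    rewrite !linearP (E1 g q) ?(E2 g q) // => x xK; apply: gq.
      exact: Kmono (leq_maxr _ _) xK.
    exact: Kmono (leq_maxl _ _) xK.
  - move=> x [Sx|[k xK]]; last by exists k => g q _ _; apply.
    exists 0%N => g q gS qS _.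
    by rewrite gS ?qS //; have [] := Sst _ Sx.
exists T; split=> //.
- apply: (good_extension Sgood) => // v vT.
  have [k kE] : exists k, forall g q, vanishing S g -> vanishing S q ->
      (forall x, x \in K k -> g (b x) = q (d (b x))) ->
      forall m, m \in v -> g m = q (d m).
    elim: v vT => [|m v IHv] vT; first by exists 0%N.
    have [|k1 E1] := IHv; first by move=> y yv; apply: vT; rewrite inE yv orbT.
    have [|k2 E2] := Tspan m; first by apply: vT; rewrite mem_head.
    exists (maxn k1 k2) => g q gS qS gq y; rewrite inE => /predU1P[->|yv].
      apply: E2 => // x xK; apply: gq; exact: Kmono (leq_maxr _ _) xK.
    apply: E1 => // x xK; apply: gq; exact: Kmono (leq_maxl _ _) xK.
  exists (tau [seq b x | x <- K k]).
    by move=> y /Ktau; apply: supported_sub => x; apply: KT.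
  move=> h hS hw; have [q qS qE] := tauP _ h hS hw; exists q => //.
  by apply: kE => // x xK; apply: qE; apply: map_f.
- by right; exists 0%N; rewrite mem_head.
pose inv k q := vanishing S q /\ forall x, x \in K k.+1 -> q (d (b x)) = f (b x).
have ex_inv k : exists q, inv k q.
  have [||q qS qE] := tauP [seq b x | x <- K k.+1] f => //.
  by exists q; split=> // x xK; rewrite -qE //; apply: map_f.
(* Two approximate primitives differ, on K k, by a coboundary; correcting the
   better one by it makes the approximations stationary. *)
have step k q : exists q', inv k q -> inv k.+1 q' /\
    forall x, x \in K k -> q' (b x) = q (b x).
  have [[qS qE]|] := pselect (inv k q); last by exists q.
  have [q1 [q1S q1E]] := ex_inv k.+1.
  have [|y yt|r rS rE] := tauP [seq b x | x <- K k] (q1 \- q).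
  - by move=> m mS; rewrite /= q1S // qS // subrr.
  - have yK := Ktau _ _ yt.
    rewrite /=; apply/eqP; rewrite subr_eq0; apply/eqP.
    apply: (supported_ext (f := q1 \o d) (g := q \o d) _ yK) => x xK /=.
    by rewrite qE ?q1E //; apply: KS.
  exists (q1 \- (r \o d)) => _; split; first split.
  - by move=> m mS; rewrite /= q1S // rS ?subrr //; apply: stable_d.
  - by move=> x xK; rewrite /= dd raddf0 subr0 q1E.
  - move=> x xK; rewrite /= -rE; last exact: map_f.
    by rewrite /= opprB addrC subrK.
have /choice[nxt nxtP] : forall kq : nat * {linear M -> L}, exists q',
    inv kq.1 kq.2 -> inv kq.1.+1 q' /\
    forall x, x \in K kq.1 -> q' (b x) = kq.2 (b x) by case=> k q; apply: step.
have [q0 q0P] := ex_inv 0%N.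
pose Q := fix Q k := if k is j.+1 then nxt (j, Q j) else q0.
have QP k : inv k (Q k) by elim: k => [//|k /(nxtP (k, _))[]].
have QS k x : x \in K k -> Q k.+1 (b x) = Q k (b x).
  by move=> xK; have [_] := nxtP (k, Q k) (QP k); apply.
have Qst k j x : (k <= j)%N -> x \in K k -> Q j (b x) = Q k (b x).
  move=> /subnK <- xK; elim: (j - k)%N => // i IHi.
  by rewrite addSn QS //; apply: Kmono xK; apply: leq_addl.
have /choice[phi phiP] : forall x, exists l : L,
    (S x -> l = 0) /\ forall k, x \in K k -> l = Q k (b x).
  move=> x; have [Sx|Sx] := pselect (S x).
    exists 0; split=> // k _; rewrite (QP k).1 //; exact: (Sst _ Sx).1.
  have [[k xK]|no] := pselect (exists k, x \in K k); last first.
    by exists 0; split=> // k xK; case: no; exists k.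
  exists (Q k (b x)); split=> // j xj.
  by have [kj|/ltnW jk] := leqP k j; [rewrite (Qst k j)|rewrite (Qst j k)].
have [H HE] := free_lift_exists phi; exists H => [x Sx|x Tx].
  by rewrite HE; apply: (phiP x).1.
have [Sx|[k xK]] := Tx.
  have [bS dS] := Sst _ Sx; rewrite fS //.
  apply: esym; apply: (free_span_on (P := fun z => H z = 0)) dS.
  - by rewrite raddf0.
  - by move=> a y y' Hy Hy'; rewrite linearP Hy Hy' scaler0 addr0.
  - by move=> y Sy; rewrite HE; apply: (phiP y).1.
have HQ : H (s (d (b x))) = Q k.+1 (p (s (d (b x)))).
  apply: (free_span_on (P := fun z => H z = Q k.+1 (p z))) (Kd _ _ xK).
  - by rewrite !raddf0.
  - by move=> a y y' Hy Hy'; rewrite !linearP Hy Hy'.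
  - by move=> y yK; rewrite HE; apply: (phiP y).2.
by rewrite HQ ps (QP k.+1).2 //; apply/KS/KS.
Qed.

Lemma good_empty : good (fun _ => False).
Proof.
split=> // v v0; exists [::] => // h _; exists h => x /v0 x0.
have -> : x = 0.
  by rewrite -(ps x) -[RHS](raddf0 p); congr (p _); apply: dsum_ext => y; apply: x0.
by rewrite !raddf0.
Qed.

(** Zorn's lemma for the pairs of a good set S and a primitive of f on the
    elements supported in S. *)
Theorem local_to_global f :
  (forall v, exists w, lifts w v) -> (forall m, f (d m) = 0) ->
  exists q, forall m, f m = q (d m).
Proof.
move=> loc fd.
pose sol S (H : {linear free_mod R X -> L}) :=
  good S /\ forall x, S x -> f (b x) = H (s (d (b x))).
pose ST : Type := {SH : (X -> Prop) * {linear free_mod R X -> L} | sol SH.1 SH.2}.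
pose dom (t : ST) := (sval t).1; pose val (t : ST) := (sval t).2.
pose le (t t' : ST) : bool :=
  `[< forall x, dom t x -> dom t' x /\ val t (gen R x) = val t' (gen R x) >].
have [H0 _] := free_lift_exists (fun _ : X => 0 : L).
have sol0 : sol (fun _ => False) H0 by split=> //; apply: good_empty.
have agree S (H H' : {linear free_mod R X -> L}) z :
    (forall x, S x -> H (gen R x) = H' (gen R x)) ->
    (forall x, ~ S x -> z x = 0) -> H z = H' z.
  move=> HH'; apply: (free_span_on (P := fun z => H z = H' z)) => //.
    by rewrite !raddf0.
  by move=> a y y' Hy Hy'; rewrite !linearP Hy Hy'.
have [|r t u /asboolP rt /asboolP tu|Ch tot|[[S H] [Sgood SH]] tmax] :=
    @ZL_preorder ST (exist _ (_, H0) sol0) le.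
- by move=> t; apply/asboolP.
- apply/asboolP => x /rt[tx ->]; exact: tu.
- have [[t1 Ch1]|no] := pselect (exists t, Ch t); last first.
    by exists (exist _ (_, H0) sol0) => t Ct; case: no; exists t.
  pose S x := exists2 t, Ch t & dom t x.
  have common (r : seq X) :
      exists2 t, Ch t & forall x, x \in r -> S x -> dom t x.
    elim: r => [|x r [t Ct tr]]; first by exists t1.
    have [[t' Ct' t'x]|Sx] := pselect (S x); last first.
      by exists t => // y; rewrite inE => /predU1P[->|yr]; [|apply: tr].
    have [/asboolP le_tt'|/asboolP le_t't] := tot _ _ Ct Ct'.
      exists t' => // y; rewrite inE => /predU1P[->//|yr Sy].
      by have [] := le_tt' y (tr _ yr Sy).
    exists t => // y; rewrite inE => /predU1P[->|yr]; last exact: tr.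
    by have [] := le_t't x t'x.
  have /choice[phi phiP] : forall x, exists l, forall t, Ch t -> dom t x ->
      l = val t (gen R x).
    move=> x; have [[t Ct tx]|no] := pselect (S x); last first.
      by exists 0 => t Ct tx; case: no; exists t.
    exists (val t (gen R x)) => t' Ct' t'x.
    have [/asboolP le_tt'|/asboolP le_t't] := tot _ _ Ct Ct'.
      by have [] := le_tt' _ tx.
    by have [] := le_t't _ t'x.
  have [H HE] := free_lift_exists phi.
  have domS t x : Ch t -> dom t x -> S x by move=> Ct tx; exists t.
  have Sgood : good S.
    split=> [x [t Ct tx]|v vS].
      have [[tst _] _] := svalP t; have [bx dx] := tst x tx.
      by split; [apply: supported_sub bx|apply: supported_sub dx] => y; apply: domS.
    have /choice[sig sigP] := supported_finite.
    have [t Ct tr] := common (flatten [seq sig y | y <- v]).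
    have [[_ tloc] _] := svalP t; have [|w wS wl] := tloc v.
      move=> y yv x tx.
      have [xy|/negP xy] := boolP (x \in sig y); last exact: sigP.
      apply: vS => // Sx; apply: tx; apply: tr => //.
      by apply/flatten_mapP; exists y.
    by exists w => // y /wS; apply: supported_sub => x; apply: domS.
  have solSH : sol S H.
    split=> // x [t Ct tx]; have [[tst _] tE] := svalP t.
    rewrite tE //; apply: agree (tst x tx).2 => y ty.
    by rewrite HE; apply/esym/phiP.
  exists (exist _ (S, H) solSH) => t Ct; apply/asboolP => x tx.
  by split; [exists t|rewrite /= HE; apply/esym/phiP].
have Stot x0 : S x0.
  apply: contrapT => Sx0.
  have [f1 f1E] : exists f1, forall m, f1 m = f m - H (s (d m)).
    by exists (f \- (H \o s \o d)).
  have [||T [Tgood ST' Tx0 [H1 H1S H1E]]] := @good_step S x0 f1 Sgood loc.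
  - move=> m; apply: (supported_span (P := fun m => f1 m = 0)).
    + by rewrite raddf0.
    + by move=> a m1 m2 E1 E2; rewrite linearP E1 E2 scaler0 addr0.
    + by move=> x Sx; rewrite f1E SH // subrr.
  - by move=> m; rewrite f1E fd dd !raddf0 addr0.
  have [H2 H2E] : exists H2 : {linear free_mod R X -> L},
      forall z, H2 z = H z + H1 z.
    by exists (H \+ H1).
  have solT : sol T H2.
    by split=> // x /H1E; rewrite f1E H2E => /eqP; rewrite subr_eq addrC => /eqP.
  have leT : le (exist _ (S, H) (conj Sgood SH)) (exist _ (T, H2) solT).
    by apply/asboolP => x Sx; split; [apply: ST'|rewrite /val /= H2E H1S ?addr0].
  by have := tmax _ leT => /asboolP/(_ x0 Tx0)[].
exists (H \o s) => m.
by apply: (supported_ext (S := fun _ => True) (g := H \o s \o d)) => // x _;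
  exact: (SH x (Stot x)).
Qed.

End LocalToGlobal.

(** * Tensor products with character modules of free modules *)

Section TensorTools.
Variable R : pzRingType.

Lemma tensor_lift_exists (E : lmodType R^c) (M : lmodType R) (A : zmodType)
    (f : E -> M -> A) :
  (forall m, {morph f^~ m : e e' / e + e'}) ->
  (forall e, {morph f e : m m' / m + m'}) ->
  (forall (a : R) e m, f ((a : R^c) *: e) m = f e (a *: m)) ->
  exists F : {additive tensor E M -> A}, forall e m, F (tmk e m) = f e m.
Proof.
move=> fDl fDr fZ.
pose H := GRing.isZmodMorphism.Build (tensor E M) A (tensor_lift f)
  (tensor_lift_is_additive fDl fDr fZ).
exists (HB.pack_for {additive tensor E M -> A} (tensor_lift f) H) => e m.
exact: tensor_lift_mk.
Qed.

Lemma tmk0l (E : lmodType R^c) (M : lmodType R) (m : M) : tmk (0 : E) m = 0.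
Proof. by apply: (addIr (tmk (0 : E) m)); rewrite -tmkDl !add0r. Qed.

Lemma tmk0r (E : lmodType R^c) (M : lmodType R) (e : E) : tmk e (0 : M) = 0.
Proof. by apply: (addIr (tmk e (0 : M))); rewrite -tmkDr !add0r. Qed.

Lemma tmkNl (E : lmodType R^c) (M : lmodType R) (e : E) (m : M) :
  tmk (- e) m = - tmk e m.
Proof. by apply: (addIr (tmk e m)); rewrite -tmkDl !addNr tmk0l. Qed.

Lemma tmk_suml (E : lmodType R^c) (M : lmodType R) I (r : seq I)
    (e : I -> E) (m : M) :
  tmk (\sum_(i <- r) e i) m = \sum_(i <- r) tmk (e i) m.
Proof. by apply: (big_morph _ (tmkDl m) (tmk0l _ m)). Qed.

Lemma tmk_sumr (E : lmodType R^c) (M : lmodType R) I (r : seq I)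
    (e : E) (m : I -> M) :
  tmk e (\sum_(i <- r) m i) = \sum_(i <- r) tmk e (m i).
Proof. by apply: (big_morph _ (tmkDr e) (tmk0r _ e)). Qed.

Lemma tensor_sum (E : lmodType R^c) (M : lmodType R) (t : tensor E M) :
  exists r : seq (E * M), t = \sum_(u <- r) tmk u.1 u.2.
Proof.
elim/tensor_ind: t => [e m|_ _ [r ->] [r' ->]].
  by exists [:: (e, m)]; rewrite big_seq1.
exists (r ++ [seq (- u.1, u.2) | u <- r']).
rewrite big_cat big_map -sumrN; congr (_ + _); apply: eq_bigr => u _.
by rewrite tmkNl.
Qed.

(** In terms of a dual basis, elements of a tensor product with a projective
    module have coordinates. *)
Lemma tensor_eq_coords (E : lmodType R^c) (P : lmodType R)
    (p : {linear free_mod R P -> P}) (s : {linear P -> free_mod R P})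
    (I J : eqType) (r : seq I) (r' : seq J)
    (e : I -> E) (m : I -> P) (e' : J -> E) (m' : J -> P) :
  (forall x, p (gen R x) = x) -> (forall x, p (s x) = x) ->
  (forall x, \sum_(i <- r) (s (m i) x : R^c) *: e i =
             \sum_(j <- r') (s (m' j) x : R^c) *: e' j) ->
  \sum_(i <- r) tmk (e i) (m i) = \sum_(j <- r') tmk (e' j) (m' j).
Proof.
move=> pE ps coordE.
have cover (K : eqType) (q : seq K) (n : K -> P) :
    exists t : seq P, forall i, i \in q -> forall x, x \notin t -> s (n i) x = 0.
  have /choice[u uP] : forall i, exists u : seq P, forall x, x \notin u -> s (n i) x = 0.
    by move=> i; apply: dsum_supp.
  exists (flatten [seq u i | i <- q]) => i iq x xu; apply: uP.
  by apply: contra xu => xu; apply/flatten_mapP; exists i.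
have expand (K : eqType) (q : seq K) (f : K -> E) (n : K -> P) (t : seq P) :
    uniq t -> (forall i, i \in q -> forall x, x \notin t -> s (n i) x = 0) ->
    \sum_(i <- q) tmk (f i) (n i) =
    \sum_(x <- t) tmk (\sum_(i <- q) (s (n i) x : R^c) *: f i) x.
  move=> ut tq; under [RHS]eq_bigr => x _ do rewrite tmk_suml.
  rewrite exchange_big; apply: eq_big_seq => i iq /=.
  rewrite -{1}[n i]ps {1}(free_decomp ut (tq i iq)) linear_sum tmk_sumr.
  by apply: eq_bigr => x _; rewrite linearZ /= pE tmkZ.
have [t tr] := cover I r m; have [t' tr'] := cover J r' m'.
pose T := undup (t ++ t').
have uT : uniq T by apply: undup_uniq.
rewrite (expand _ r e m T uT) ?(expand _ r' e' m' T uT).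
- by apply: eq_bigr => x _; rewrite coordE.
- by move=> j jr x; rewrite mem_undup mem_cat negb_or => /andP[_]; apply: tr'.
- by move=> i ir x; rewrite mem_undup mem_cat negb_or => /andP[+ _]; apply: tr.
Qed.

Lemma free_additive_ext (Y : eqType) (A : zmodType)
    (f g : {additive free_mod R Y -> A}) :
  (forall y (r : R), f (r *: gen R y) = g (r *: gen R y)) -> forall l, f l = g l.
Proof.
move=> fg; apply: dsum_span => [|l l' fl fl'|y r]; first by rewrite !raddf0.
  by rewrite !raddfD fl fl'.
by rewrite din_gen.
Qed.

Lemma pairing_exists (Y : eqType) (e : cofree R^c Y) :
  exists h : {additive free_mod R Y -> rational_circle},
    forall y (r : R), h (r *: gen R y) = e y r.
Proof.
have /choice[h hE] : forall y, exists h : {additive R^o -> rational_circle},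
    forall r : R, h r = e y r.
  by move=> y; apply: additive_of_fun => r r'; apply: (coindB (e y)).
have [H HE] := dsum_lift_additive (C := fun _ : Y => R^o) h.
by exists H => y r; rewrite -din_gen HE hE.
Qed.

(** The pairing identifies cofree R^c Y with the character module of the free
    module on Y. *)
Definition pairing (Y : eqType) (e : cofree R^c Y) :=
  sval (cid (pairing_exists e)).

Lemma pairingE (Y : eqType) (e : cofree R^c Y) y (r : R) :
  pairing e (r *: gen R y) = e y r.
Proof. by rewrite /pairing; case: cid. Qed.

Lemma pairingDl (Y : eqType) (l : free_mod R Y) :
  {morph (fun e : cofree R^c Y => pairing e l) : e e' / e + e'}.
Proof.
move=> e e' /=; apply: (@free_additive_ext _ _ _ (pairing e \+ pairing e')) => y r.
by rewrite /= !pairingE.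
Qed.

Lemma pairingZ (Y : eqType) (a : R) (e : cofree R^c Y) (l : free_mod R Y) :
  pairing ((a : R^c) *: e) l = pairing e (a *: l).
Proof.
have [h hE] : exists h : {additive free_mod R Y -> rational_circle},
    forall l, h l = pairing e (a *: l).
  by apply: additive_of_fun => l' l''; rewrite scalerBr raddfB.
rewrite -hE; apply: free_additive_ext => y r.
by rewrite hE scalerA !pairingE.
Qed.

End TensorTools.

Section Families.
Variables (k : nat) (V : zmodType).

Definition single (j : 'I_k) (v : V) : 'I_k -> V := fun i => if i == j then v else 0.

Lemma singleB j v v' : single j (v - v') = single j v - single j v'.
Proof.
apply: funext => i; rewrite /single /GRing.add /GRing.opp /=.
by case: (i == j); rewrite ?subr0.
Qed.

Lemma single_sum (a : 'I_k -> V) : a = \sum_j single j (a j).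
Proof.
apply: funext => i.
have -> : (\sum_j single j (a j)) i = \sum_j single j (a j) i.
  by elim/big_rec2: _ => // j x y _ <-.
rewrite (bigD1 i) //= /single eqxx big1 ?addr0 // => j ji.
by rewrite eq_sym (negbTE ji).
Qed.

End Families.

Definition hom_acyclic (R : pzRingType) (C : complex R) (V : lmodType R) : Prop :=
  forall (n : int) (f : {linear C (n + 1) -> V}),
    (forall x, f (cdiff C (n + 1) x) = 0) ->
    exists g : {linear C n -> V}, forall x, g (cdiff C n x) = f x.

Lemma hom_exactE (R : pzRingType) (C : complex R) (V : lmodType R) :
  hom_exact C V <-> hom_acyclic C V.
Proof.
split=> CV n f; first by move=> /CV.
by split=> [/CV//|[g gE] x]; rewrite -gE cdiff_comp raddf0.
Qed.

(** * Projectively coresolved Gorenstein flat modules are Gorenstein projective *)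

Lemma coind_sumE (S : pzRingType) I (r : seq I) (F : I -> coind S) a :
  (\sum_(i <- r) F i) a = \sum_(i <- r) F i a.
Proof. by elim/big_rec2: _ => // i x y _ <-. Qed.

Lemma cofree_sumE (S : pzRingType) Y I (r : seq I) (F : I -> cofree S Y) y :
  (\sum_(i <- r) F i) y = \sum_(i <- r) F i y.
Proof. by elim/big_rec2: _ => // i x z _ <-. Qed.

Section TensorLocal.
Variables (R : pzRingType) (C : complex R).
Hypothesis Cproj : forall n, projective_module (C n).
Hypothesis Ctens : forall E : lmodType R^c, injective_module E -> tensor_exact E C.

(** Suppose that no finite list w works, and let F w be a cochain that is closed on
    w but not exact on t; a character chi w of the families of values on t kills
    the coboundaries, but not F w. All these characters together are the
    coefficients in cofree of an element tau of the tensor product. It is a cycle,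
    hence the boundary of some tau', which involves a finite list w only. For this
    w, pairing tau with F w leads to a contradiction. *)
Lemma tensor_local (Y : eqType) (n : int) (t : seq (C (n + 1))) :
  exists w : seq (C (n + 1 + 1)), forall f : {linear C (n + 1) -> free_mod R Y},
    (forall y, y \in w -> f (cdiff C (n + 1) y) = 0) ->
    exists h : {linear C n -> free_mod R Y},
      forall x, x \in t -> f x = h (cdiff C n x).
Proof.
pose L : lmodType R := free_mod R Y.
pose k := size t; pose x (j : 'I_k) := tnth (in_tuple t) j.
pose A : zmodType := ('I_k -> L).
pose exact_value (a : A) :=
  exists h : {linear C n -> L}, forall j, a j = h (cdiff C n (x j)).
have ev0 : exact_value 0.
  have [h hE] : exists h : {linear C n -> L}, forall c, h c = 0.
    by apply: linear_of_fun => a u v; rewrite scaler0 addr0.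
  by exists h => j; rewrite hE.
have evB a a' : exact_value a -> exact_value a' -> exact_value (a - a').
  move=> [h hE] [h' h'E]; exists (h \- h') => j.
  by rewrite /= -hE -h'E.
apply: contrapT => /forallNP bad.
have /choice[F FP] : forall w : seq (C (n + 1 + 1)),
    exists f : {linear C (n + 1) -> L},
    (forall y, y \in w -> f (cdiff C (n + 1) y) = 0) /\
    ~ exact_value (fun j => f (x j)).
  move=> w; have /existsNP[f /not_implyP[fw fx]] := bad w.
  exists f; split=> // -[h hE]; apply: fx; exists h => z zt.
  have /tnthP[j ->] : z \in in_tuple t by [].
  exact: hE.
have /choice[chi chiP] : forall w : seq (C (n + 1 + 1)),
    exists chi : {additive A -> rational_circle},
    (forall a, exact_value a -> chi a = 0) /\ chi (fun j => F w (x j)) != 0.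
  move=> w; have [chi chi0 chiF] := character_separates ev0 evB (FP w).2.
  by exists chi.
have eP j wy : zmod_morphism
    (fun r : R^c => chi wy.1 (single j ((r : R) *: gen R wy.2))).
  by move=> r r'; rewrite [in LHS]scalerBl singleB raddfB.
pose E : lmodType R^c := cofree R^c (seq (C (n + 1 + 1)) * Y).
pose e (j : 'I_k) : E := fun wy => Coind (eP j wy).
pose tau : tensor E (C (n + 1)) := \sum_j tmk (e j) (x j).
have dtau : tensor_map (cdiff C n) tau = 0.
  have [p [s [pE sE]]] := projective_section (@Cproj n).
  rewrite /tau raddf_sum; under eq_bigr => j _ do rewrite /= tensor_map_mk.
  rewrite -[RHS](big_nil 0 +%R predT (fun j => tmk (e j) (cdiff C n (x j)))).
  apply: (tensor_eq_coords pE sE) => c; rewrite big_nil.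
  apply: funext => -[w y]; apply: coind_ext => a; rewrite cofree_sumE coind_sumE.
  have [h hE] : exists h : {linear C n -> L},
      forall m, h m = (s m c : R) *: ((a : R) *: gen R y).
    move: (_ *: gen R y) => l; apply: linear_of_fun => b u v.
    by rewrite linearP scalerA -scalerDl.
  have /(chiP w).1 : exact_value (fun j => h (cdiff C n (x j))) by exists h.
  rewrite [X in chi w X]single_sum raddf_sum => h0; rewrite -[RHS]h0.
  by apply: eq_bigr => j _; rewrite hE scalerA.
have [tau' tau'E] := (@Ctens E (@cofree_injective R^c _) n tau).1 dtau.
have [r rE] := tensor_sum tau'.
pose w := [seq u.2 | u <- r].
pose at_w (ep : E) : cofree R^c Y := fun y => ep (w, y).
have [Phi PhiE] : exists Phi : {additive tensor E (C (n + 1)%R) -> rational_circle},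
    forall ep c, Phi (tmk ep c) = pairing (at_w ep) (F w c).
  apply: tensor_lift_exists.
  - by move=> c ep ep'; rewrite -[at_w (ep + ep')]/(at_w ep + at_w ep') pairingDl.
  - by move=> ep c c'; rewrite !raddfD.
  - move=> a ep c; rewrite -[at_w _]/((a : R^c) *: at_w ep) pairingZ linearZ.
    by [].
have /eqP[] := (chiP w).2.
rewrite [X in chi w X]single_sum raddf_sum.
transitivity (Phi tau).
  rewrite /tau raddf_sum; apply: eq_bigr => j _; rewrite /= PhiE.
  have [h hE] : exists h : {additive L -> rational_circle},
      forall l, h l = chi w (single j l).
    by apply: additive_of_fun => l l'; rewrite singleB raddfB.
  rewrite -hE; apply: free_additive_ext => y a.
  by rewrite hE pairingE.
rewrite -tau'E rE !raddf_sum big1_seq // => u /andP[_ ur].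
by rewrite /= tensor_map_mk PhiE (FP w).1 ?raddf0 //; apply: map_f.
Qed.

End TensorLocal.

(** Forgetting the grading of C makes local_to_global applicable. *)
Section TotalComplex.
Variables (R : pzRingType) (C : complex R).

Local Notation M := (dsum (fun i : int => C i)).
Local Notation inc n := (@din R int (fun i : int => C i) n).

Lemma total_diff : exists d : {linear M -> M},
  (forall x n, d x n = cdiff C n (x (n + 1))) /\
  forall n c, d (inc (n + 1) c) = inc n (cdiff C n c).
Proof.
have dP (x : M) : fin_supp (fun n => cdiff C n (x (n + 1))).
  have [r rx] := dsum_supp x; exists [seq n - 1 | n <- r] => n nr.
  rewrite rx ?raddf0 //; apply: contra nr => nr.
  by apply/mapP; exists (n + 1); rewrite ?addrK.
have [|d dE] := @linear_of_fun R M M (fun x => Dsum (dP x)).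
  by move=> a x y; apply: dsum_ext => n; apply: linearP.
exists d; split=> [x n|n c]; first by rewrite dE.
apply: dsum_ext => m; rewrite dE /=.
have [nm|nm] := eqVneq n m; first by case: m / nm; rewrite !din_fun_id.
rewrite !din_fun_neq ?raddf0 //.
by apply: contra nm => /eqP/addIr/eqP.
Qed.

Hypothesis Cproj : forall n, projective_module (C n).

Lemma hom_acyclic_of_local (Y : eqType) :
  (forall n (t : seq (C (n + 1))),
    exists w : seq (C (n + 1 + 1)), forall f : {linear C (n + 1) -> free_mod R Y},
      (forall y, y \in w -> f (cdiff C (n + 1) y) = 0) ->
      exists h : {linear C n -> free_mod R Y},
        forall x, x \in t -> f x = h (cdiff C n x)) ->
  hom_acyclic C (free_mod R Y).
Proof.
move=> loc n f fd; have [d [dE dinc]] := total_diff.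
have [p [s [_ ps]]] :=
  projective_section (@projective_sum R _ (fun n => C n) Cproj).
have [F FE] : exists F : {linear M -> free_mod R Y},
    forall x, F x = f (x (n + 1)).
  by apply: linear_of_fun => a x y; rewrite -linearP.
have dd m : d (d m) = 0.
  by apply: dsum_ext => i; rewrite !dE; apply: cdiff_comp.
have [v|m|q qE] := local_to_global ps dd (f := F); last first.
- have [g gE] : exists g : {linear C n -> free_mod R Y},
      forall c, g c = q (inc n c).
    by exists (q \o inc n).
  by exists g => x; rewrite gE -dinc -qE FE dinE.
- by rewrite FE dE fd.
have [r r_uniq rv] : exists2 r : seq int, uniq r &
    forall x, x \in v -> forall i, i \notin r -> x (i + 1) = 0.
  have /choice[u uP] : forall x : M,
      exists u : seq int, forall i, i \notin u -> x i = 0.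
    by move=> x; apply: dsum_supp.
  exists (undup [seq i - 1 | i <- flatten [seq u x | x <- v]]).
    exact: undup_uniq.
  move=> x xv i; rewrite mem_undup => iu; apply: uP; apply: contra iu => iu.
  apply/mapP; exists (i + 1); last by rewrite addrK.
  by apply/flatten_mapP; exists x.
have /dep_choice[wn wnP] := fun i => loc i [seq x (i + 1) | x : M <- v].
exists (flatten [seq [seq inc (i + 1 + 1) y | y <- wn i] | i <- r]) => h hw.
have /dep_choice[hn hnE] : forall i, exists g : {linear C i -> free_mod R Y},
    i \in r -> forall x, x \in v ->
    h (inc (i + 1) (x (i + 1))) = g (cdiff C i (x (i + 1))).
  move=> i; have [ir|_] := boolP (i \in r); last first.
    by exists (h \o inc i).
  have [y yw|g gE] := wnP i (h \o inc (i + 1)).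
    rewrite /= -dinc; apply: hw; apply/flatten_mapP; exists i => //.
    exact: map_f.
  exists g => _ x xv; rewrite -gE //.
  by apply/mapP; exists x.
have [q qE] := dsum_lift hn; exists q => x xv.
have xE : x = \sum_(i <- r) inc (i + 1) (x (i + 1)).
  rewrite {1}(@dsum_decomp _ _ _ x [seq i + 1 | i <- r]) ?big_map //.
    by rewrite map_inj_uniq // => i j /addIr.
  move=> i ir; rewrite -(subrK 1 i); apply: rv => //; apply: contra ir => ir.
  by apply/mapP; exists (i - 1); rewrite ?subrK.
have dxE : d x = \sum_(i <- r) inc i (cdiff C i (x (i + 1))).
  rewrite (@dsum_decomp _ _ _ (d x) r) //; last first.
    by move=> i ir; rewrite dE rv ?raddf0.
  by apply: eq_bigr => i _; rewrite dE.
rewrite {1}xE dxE !raddf_sum; apply: eq_big_seq => i ir /=.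
by rewrite qE hnE.
Qed.

End TotalComplex.

Section PGF.
Variable R : pzRingType.

Lemma hom_acyclic_retract (C : complex R) (V W : lmodType R)
    (i : {linear V -> W}) (p : {linear W -> V}) :
  (forall v, p (i v) = v) -> hom_acyclic C W -> hom_acyclic C V.
Proof.
move=> pi CW n f fd; have [x|g gE] := CW n (i \o f); first by rewrite /= fd raddf0.
by exists (p \o g) => x; rewrite /= gE /= pi.
Qed.

(** This is a theorem of Saroch and Stovicek. *)
Theorem PGF_gorenstein_projective (M : lmodType R) :
  PGF M -> gorenstein_projective M.
Proof.
case=> C [Cproj Cex Ctens CM]; exists C; split=> // Q Qproj; apply/hom_exactE.
have [p [s [_ ps]]] := projective_section Qproj.
apply: hom_acyclic_retract ps _; apply: hom_acyclic_of_local => // n t.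
exact: tensor_local.
Qed.

End PGF.

(** * Short exact sequences and projective dimension *)

Section Homological.
Variable R : pzRingType.
Implicit Types A B D J K M N P V X : lmodType R.

Definition ses A B D (i : {linear A -> B}) (p : {linear B -> D}) : Prop :=
  [/\ injective i, exact_at i p & forall d, exists b, p b = d].

Lemma ses_of_epi B D (p : {linear B -> D}) : (forall d, exists b, p b = d) ->
  exists (K : lmodType R) (i : {linear K -> B}), ses i p.
Proof.
move=> psurj; have [|K [i [iinj iE]]] := @submodule_of_pred R B (fun x => p x = 0).
  by split=> [|a x y px py]; rewrite ?linear0 // linearP px py scaler0 addr0.
by exists K, i; split=> // x; apply: iE.
Qed.

Lemma ses_of_mono A B (i : {linear A -> B}) : injective i ->
  exists (D : lmodType R) (p : {linear B -> D}), ses i p.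
Proof.
move=> iinj; have [|D [p [psurj pE]]] :=
  @quotient_by_pred R B (fun x => exists a, i a = x).
  split=> [|a _ _ [x <-] [y <-]]; first by exists 0; rewrite linear0.
  by exists (a *: x + y); rewrite linearP.
by exists D, p; split=> // y; apply: pE.
Qed.

Lemma mono_lift A B (i : {linear A -> B}) X (f : {linear X -> B}) :
  injective i -> (forall x, exists a, i a = f x) ->
  exists g : {linear X -> A}, forall x, i (g x) = f x.
Proof.
move=> iinj fi; apply: (linear_of_rel (r := fun x a => i a = f x)) => //.
  by move=> k x a x' a' ax ax'; rewrite !linearP ax ax'.
by move=> a; rewrite linear0 => ia; apply: iinj; rewrite ia linear0.
Qed.

Lemma ses_lift A B D (i : {linear A -> B}) (p : {linear B -> D}) X
    (f : {linear X -> B}) :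
  ses i p -> (forall x, p (f x) = 0) ->
  exists g : {linear X -> A}, forall x, i (g x) = f x.
Proof.
by case=> iinj ipE _ pf; apply: mono_lift => // x; apply/ipE.
Qed.

Lemma ses_factor A B D (i : {linear A -> B}) (p : {linear B -> D}) X
    (f : {linear B -> X}) :
  ses i p -> (forall a, f (i a) = 0) ->
  exists g : {linear D -> X}, forall b, g (p b) = f b.
Proof.
case=> iinj ipE psurj fi.
have [|||g gE] := @linear_of_rel R D X (fun d x => exists b, p b = d /\ f b = x).
- by move=> d; have [b bd] := psurj d; exists (f b), b.
- move=> k _ _ _ _ [b [<- <-]] [b' [<- <-]]; exists (k *: b + b').
  by rewrite !linearP.
- by move=> x [b [/ipE[a <-] <-]].
exists g => b; have [b' [bb' <-]] := gE (p b).
have /ipE[a aE] : p (b - b') = 0 by rewrite linearB bb' subrr.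
by apply/esym/eqP; rewrite -subr_eq0 -linearB -aE fi.
Qed.

(** This says that Ext^1(M, N) = 0; it includes the case where f is the identity
    of N, in which g is a retraction. *)
Definition ext1_zero M N : Prop :=
  forall A B (i : {linear A -> B}) (p : {linear B -> M}), ses i p ->
  forall f : {linear A -> N}, exists g : {linear B -> N}, forall a, g (i a) = f a.

Lemma ext1_of_presentation M N K P (k : {linear K -> P}) (q : {linear P -> M}) :
  projective_module P -> ses k q ->
  (forall f : {linear K -> N},
     exists g : {linear P -> N}, forall a, g (k a) = f a) ->
  ext1_zero M N.
Proof.
move=> Pproj [kinj kqE qsurj] ext A B i p [iinj ipE psurj] f.
have [u uE] := Pproj _ _ p q psurj.
have [|v vE] := @ses_lift A B M i p K (u \o k) (And3 iinj ipE psurj).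
  by move=> x; rewrite /= uE; apply/kqE; exists x.
have [g gE] := ext (f \o v).
have [|||h hE] := @linear_of_rel R B N
  (fun b n => exists a y, b = i a + u y /\ n = f a + g y).
- move=> b; have [y yb] := qsurj (p b).
  have /ipE[a aE] : p (b - u y) = 0 by rewrite linearB uE yb subrr.
  by exists (f a + g y), a, y; rewrite aE subrK.
- move=> c _ _ _ _ [a [y [-> ->]]] [a' [y' [-> ->]]].
  exists (c *: a + a'), (c *: y + y').
  by rewrite !linearP !scalerDr; split; rewrite addrACA.
- move=> _ [a [y [e ->]]].
  have /kqE[x xy] : q y = 0.
    have pi : p (i a) = 0 by apply/ipE; exists a.
    by rewrite -uE -[LHS]add0r -pi -linearD -e linear0.
  have -> : a = - v x.
    by apply: iinj; rewrite linearN vE /= xy; apply/eqP; rewrite -addr_eq0 -e.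
  by rewrite linearN -xy gE /= addNr.
exists h => a; have [a' [y [e hia]]] := hE (i a).
have /kqE[x xy] : q y = 0.
  have pi c : p (i c) = 0 by apply/ipE; exists c.
  by rewrite -uE -[LHS]add0r -(pi a') -linearD -e pi.
have aE : a = a' + v x by apply: iinj; rewrite linearD vE /= xy.
by rewrite hia aE -xy gE linearD.
Qed.

Lemma ext1_lift K N' J N (i : {linear N' -> J}) (q : {linear J -> N})
    (f : {linear K -> N}) :
  ext1_zero K N' -> ses i q -> exists g : {linear K -> J}, forall x, q (g x) = f x.
Proof.
move=> ext [iinj iqE qsurj].
(* The pullback of q along f is an extension of K by N', hence has a
   retraction onto N'. *)
have [|B [b [binj bE]]] :=
    @submodule_of_pred R (K * J)%type (fun u => q u.2 = f u.1).
  split=> [|a u v /= qu qv]; first by rewrite /= !linear0.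
  by rewrite !linearP qu qv.
have [p pE] : exists p : {linear B -> K}, forall x, p x = (b x).1.
  by apply: linear_of_fun => a x y; rewrite linearP.
have [j jE] : exists j : {linear N' -> B}, forall n, b (j n) = (0, i n).
  apply: (linear_of_rel (r := fun n x => b x = (0, i n)))
    => [n|c n x n' x' bx bx'|x bx].
  - by apply/bE; rewrite /= linear0; apply/iqE; exists n.
  - by rewrite !linearP bx bx'; congr (_, _); rewrite /= ?scaler0 ?addr0.
  - by apply: binj; rewrite bx !linear0.
have [|r rE] := ext _ _ j p _ idfun.
  split.
  - move=> n n' nn; apply: iinj.
    by have /(congr1 snd) := congr1 b nn; rewrite /= !jE.
  - move=> x; split=> [px|[n <-]]; last by rewrite pE jE.
    have /iqE[n nE] : q (b x).2 = 0.
      have /bE -> : exists y, b y = b x by exists x.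
      by rewrite -pE px linear0.
    exists n; apply: binj; rewrite jE nE; move: px; rewrite pE.
    by case: (b x) => /= ? ? ->.
  - move=> k; have [y yE] := qsurj (f k).
    have /bE[x xE] : q (k, y).2 = f (k, y).1 by [].
    by exists x; rewrite pE xE.
have [|||g gE] := @linear_of_rel R K J
  (fun k y => exists x, (b x).1 = k /\ (b x).2 - i (r x) = y).
- move=> k; have [y yE] := qsurj (f k).
  have /bE[x xE] : q (k, y).2 = f (k, y).1 by [].
  by exists ((b x).2 - i (r x)), x; rewrite xE.
- move=> c _ _ _ _ [x [<- <-]] [x' [<- <-]]; exists (c *: x + x').
  rewrite (linearP b) (linearP r) (linearP i); split=> //=.
  by rewrite opprD addrACA scalerBr.
- move=> _ [x [bx0 <-]].
  have /iqE[n nE] : q (b x).2 = 0.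
    have /bE -> : exists y, b y = b x by exists x.
    by rewrite bx0 linear0.
  have -> : x = j n by apply: binj; rewrite jE nE -bx0; case: (b x).
  by rewrite rE jE /= subrr.
exists g => k; have [x [<- <-]] := gE k; rewrite linearB.
have -> : q (i (r x)) = 0 by apply/iqE; exists (r x).
by rewrite subr0; apply/bE; exists x.
Qed.

Lemma zero_linear A B : exists f : {linear A -> B}, forall x, f x = 0.
Proof. by apply: linear_of_fun => a x y; rewrite scaler0 addr0. Qed.

Lemma ext1_projective P N : projective_module P -> ext1_zero P N.
Proof.
move=> Pproj; have [|K [k kses]] := @ses_of_epi P P idfun; first by move=> x; exists x.
apply: (ext1_of_presentation Pproj kses) => f.
have [g _] := zero_linear P N; exists g => a.
have [kinj kE _] := kses.
suff -> : a = 0 by rewrite !linear0.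
by apply: kinj; rewrite linear0; apply/kE; exists a.
Qed.

Lemma projective_retract P V (i : {linear V -> P}) (p : {linear P -> V}) :
  projective_module P -> (forall v, p (i v) = v) -> projective_module V.
Proof.
move=> Pproj pi A B g f gsurj; have [h hE] := Pproj A B g (f \o p) gsurj.
by exists (h \o i) => v; rewrite /= hE /= pi.
Qed.

Lemma projective_of_ext1 V : (forall N, ext1_zero V N) -> projective_module V.
Proof.
move=> ext; have [p pE] := free_lift_exists (fun x : V => x).
have psurj v : exists x, p x = v by exists (gen R v).
have [K [k kses]] := ses_of_epi psurj.
have [kinj kE _] := kses.
have [r rE] := ext K _ _ _ _ kses idfun.
have [s sE] := @ses_factor _ _ _ k p _ (idfun \- (k \o r)) kses
  (fun a => etrans (congr1 (fun y => k a - k y) (rE a)) (subrr _)).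
apply: (projective_retract (P := free_mod R V) (i := s) (p := p)).
  exact: free_projective.
move=> v; have [x <-] := psurj v; rewrite sE /= linearB.
suff -> : p (k (r x)) = 0 by rewrite subr0.
by apply/kE; exists (r x).
Qed.

Fixpoint pd_le (n : nat) (V : lmodType R) : Prop :=
  if n is m.+1 then
    exists (K P : lmodType R) (i : {linear K -> P}) (p : {linear P -> V}),
      [/\ projective_module P, ses i p & pd_le m K]
  else projective_module V.

Fixpoint cosyzygy (n : nat) (N : lmodType R) : Prop :=
  if n is m.+1 then
    exists (N' J : lmodType R) (i : {linear N' -> J}) (q : {linear J -> N}),
      [/\ injective_module J, ses i q & cosyzygy m N']
  else True.

Lemma ext1_pd n V N : pd_le n V -> cosyzygy n N -> ext1_zero V N.
Proof.
elim: n V N => [|n IHn] V N /=; first by move=> /ext1_projective.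
move=> [K [P [k [p [Pproj kses Kpd]]]]] [N' [J [i [q [Jinj ises N'cos]]]]].
apply: (ext1_of_presentation Pproj kses) => f.
have [g gE] := ext1_lift f (IHn _ _ Kpd N'cos) ises.
have [kinj _ _] := kses; have [h hE] := Jinj _ _ k g kinj.
by exists (q \o h) => a; rewrite /= hE gE.
Qed.

(** Testing projective dimensions against cosyzygies, rather than with syzygies,
    reduces the behaviour of pd_le under filtrations to that of Ext^1 in its first
    argument. *)
Lemma pd_of_ext1 n V : (forall N, cosyzygy n N -> ext1_zero V N) -> pd_le n V.
Proof.
elim: n V => [|n IHn] V ext; first by apply: projective_of_ext1 => N; apply: ext.
have [p pE] := free_lift_exists (fun x : V => x).
have psurj v : exists x, p x = v by exists (gen R v).
have [K [k kses]] := ses_of_epi psurj.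
exists K, (free_mod R V), k, p; split=> //; first exact: free_projective.
apply: IHn => N' N'cos A B i q qses f.
have [Y [j jinj]] := cofree_embedding N'.
have [N [c cses]] := ses_of_mono jinj.
have [iinj iqE qsurj] := qses; have [_ cE csurj] := cses.
have [h hE] := @cofree_injective R Y _ _ i (j \o f) iinj.
have [|hb hbE] := @ses_factor _ _ _ i q _ (c \o h) qses.
  by move=> a; rewrite /= hE; apply/cE; exists (f a).
have [|t tE] := ext N _ _ _ k p kses hb.
  by exists N', (cofree R Y), j, c; split=> //; apply: cofree_injective.
have [u uE] := @free_projective R V _ _ c t csurj.
have [|g gE] := @ses_lift _ _ _ j c B (h \- (u \o k \o q)) cses.
  by move=> b; rewrite /= linearB uE tE hbE subrr.
exists g => a; apply: jinj; rewrite gE /= hE.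
have -> : q (i a) = 0 by apply/iqE; exists a.
by rewrite !linear0 addr0.
Qed.

End Homological.

(** * The right orthogonal of the Gorenstein projective modules *)

Section Orthogonal.
Variable R : pzRingType.
Implicit Types A B D G J K M N P Q V W : lmodType R.

Definition totally_acyclic (C : complex R) : Prop :=
  [/\ forall n, projective_module (C n), exact_complex C
    & forall P, projective_module P -> hom_exact C P].

(** That is, Ext^1(G, V) = 0 for all Gorenstein projective modules G. *)
Definition gp_orthogonal V : Prop := forall C, totally_acyclic C -> hom_acyclic C V.

Lemma gp_orthogonal_projective P : projective_module P -> gp_orthogonal P.
Proof. by move=> Pproj C [_ _ CP]; apply/hom_exactE/CP. Qed.

Lemma gp_orthogonal_fun (I : Type) V :
  gp_orthogonal V -> gp_orthogonal (I -> V : lmodType R).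
Proof.
move=> oV C Ctot n f fd.
have /choice[g gE] : forall i, exists g : {linear C n -> V},
    forall x, g (cdiff C n x) = f x i.
  move=> i.
  have [fi fiE] : exists fi : {linear C (n + 1)%R -> V},
      forall x, fi x = f x i.
    by apply: linear_of_fun => a x y; rewrite linearP.
  have [x|g gE] := oV C Ctot n fi; first by rewrite fiE fd.
  by exists g => x; rewrite gE.
have [h hE] : exists h : {linear C n -> (I -> V : lmodType R)},
    forall x, h x = fun i => g i x.
  by apply: linear_of_fun => a x y; apply: funext => i; rewrite linearP.
by exists h => x; rewrite hE; apply: funext => i; apply: gE.
Qed.

Lemma gp_orthogonal_retract V W (i : {linear V -> W}) (p : {linear W -> V}) :
  (forall v, p (i v) = v) -> gp_orthogonal W -> gp_orthogonal V.
Proof.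
move=> pi oW C Ctot n f fd; have [x|g gE] := oW C Ctot n (i \o f).
  by rewrite /= fd linear0.
by exists (p \o g) => x; rewrite /= gE /= pi.
Qed.

Section Exact.
Variables (A B D : lmodType R) (i : {linear A -> B}) (p : {linear B -> D}).
Hypothesis ip : ses i p.

Lemma gp_orthogonal_coker : gp_orthogonal A -> gp_orthogonal B -> gp_orthogonal D.
Proof.
move=> oA oB C Ctot n f fd; have [Cproj _ _] := Ctot.
have [_ ipE psurj] := ip.
have [f' f'E] := @Cproj (n + 1) _ _ p f psurj.
have [|a aE] := ses_lift (f := f' \o cdiff C (n + 1)) ip.
  by move=> x; rewrite /= f'E fd.
have [|a' a'E] := oA C Ctot (n + 1) a.
  move=> x; have [iinj _ _] := ip; apply: iinj.
  by rewrite aE /= cdiff_comp !linear0.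
have [|g gE] := oB C Ctot n (f' \- (i \o a')).
  by move=> x; rewrite /= a'E aE subrr.
exists (p \o g) => x; rewrite /= gE /= linearB f'E.
suff -> : p (i (a' x)) = 0 by rewrite subr0.
by apply/ipE; exists (a' x).
Qed.

Lemma gp_orthogonal_ker : gp_orthogonal B -> gp_orthogonal D -> gp_orthogonal A.
Proof.
move=> oB oD C Ctot n f fd; have [Cproj _ _] := Ctot.
have [iinj ipE psurj] := ip.
have [g gE] : exists g : {linear C n -> B}, forall x, g (cdiff C n x) = i (f x).
  by apply: (oB C Ctot n (i \o f)) => x; rewrite /= fd linear0.
have [m nm] : exists m, n = m + 1 by exists (n - 1); rewrite subrK.
subst n; have [x|h hE] := oD C Ctot m (p \o g).
  by rewrite /= gE; apply/ipE; exists (f x).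
have [h' h'E] := @Cproj m _ _ p h psurj.
have [|g' g'E] := ses_lift (f := g \- (h' \o cdiff C m)) ip.
  by move=> x; rewrite /= linearB h'E hE subrr.
exists g' => x; apply: iinj; rewrite g'E /= gE.
by rewrite cdiff_comp linear0 subr0.
Qed.

End Exact.

Lemma gp_orthogonal_pd n V : pd_le n V -> gp_orthogonal V.
Proof.
elim: n V => [|n IHn] V; first exact: gp_orthogonal_projective.
move=> [K [P [i [p [Pproj ip /IHn oK]]]]].
exact: gp_orthogonal_coker ip oK (gp_orthogonal_projective Pproj).
Qed.

(** The one property of Gorenstein projective modules that bounds the projective
    dimensions of orthogonal modules. *)
Definition projectively_absorbed G : Prop :=
  exists P (i : {linear G -> P}), projective_module P /\
    forall V, gp_orthogonal V ->
    forall f : {linear G -> V},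
      exists g : {linear P -> V}, forall x, g (i x) = f x.

Lemma gp_absorbed G : gorenstein_projective G -> projectively_absorbed G.
Proof.
case=> C [Cproj Cex CQ [n [i [iinj iE]]]]; exists (C (n + 1)), i; split=> // V oV f.
have [x|c cE] := mono_lift (f := cdiff C (n + 1)) iinj.
  by apply/iE; apply: cdiff_comp.
have Ctot : totally_acyclic C by [].
have [x|g gE] := oV C Ctot (n + 1) (f \o c).
  rewrite /=; have -> : c (cdiff C (n + 1 + 1) x) = 0.
    by apply: iinj; rewrite cE cdiff_comp linear0.
  exact: linear0.
exists g => x; have /Cex[y yE] : cdiff C n (i x) = 0 by apply/iE; exists x.
by rewrite -yE gE /=; congr (f _); apply: iinj; rewrite cE.
Qed.

Lemma absorbed_zero G : (forall x : G, x = 0) -> projectively_absorbed G.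
Proof.
move=> G0; exists G, idfun; split=> [A B g f gsurj|V oV f]; last by exists f.
have [h _] := zero_linear G A.
by exists h => x; rewrite (G0 x) !linear0.
Qed.

(** Here k is the number of terms: 0 -> G_(k-1) -> ... -> G_0 -> M -> 0. *)
Fixpoint absorbed_resolution (k : nat) (M : lmodType R) : Prop :=
  if k is j.+1 then
    exists (K G : lmodType R) (i : {linear K -> G}) (p : {linear G -> M}),
      [/\ projectively_absorbed G, ses i p & absorbed_resolution j K]
  else forall x : M, x = 0.

Lemma absorbed_resolution_of_complex k M (G : nat -> lmodType R)
    (d : forall j, {linear G j.+1 -> G j}) (e : {linear G 0%N -> M}) :
  (forall j, projectively_absorbed (G j)) ->
  (forall j, (k <= j)%N -> forall x : G j, x = 0) ->
  (forall j, exact_at (d j.+1) (d j)) -> exact_at (d 0%N) e ->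
  (forall m, exists x, e x = m) ->
  absorbed_resolution k M.
Proof.
elim: k M G d e => [|k IHk] M G d e Gabs G0 dex eex esurj /=.
  by move=> m; have [x <-] := esurj m; rewrite [x](G0 0%N isT) linear0.
have [K [i ise]] := ses_of_epi esurj; have [iinj iE _] := ise.
have [x|d' d'E] := mono_lift (f := d 0%N) iinj.
  by apply/iE/eex; exists x.
exists K, (G 0%N), i, e; split=> //.
apply: (IHk K (fun j => G j.+1) (fun j => d j.+1) d') => //.
- by move=> j kj; apply: G0.
- move=> x; rewrite -(dex 0%N); split=> [d'x|dx]; first by rewrite -d'E d'x linear0.
  by apply: iinj; rewrite d'E dx linear0.
- move=> m; have /eex[x xE] : e (i m) = 0 by apply/iE; exists m.
  by exists x; apply: iinj; rewrite d'E.
Qed.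

Lemma gp_resolution_absorbed n k M : (k <= n)%N ->
  has_resolution (@gorenstein_projective R) M k -> absorbed_resolution n.+1 M.
Proof.
move=> kn [G [d [e [Ggp G0 dex eex esurj]]]].
apply: absorbed_resolution_of_complex dex eex esurj.
  move=> j; have [jk|kj] := leqP j k; first exact/gp_absorbed/Ggp.
  exact/absorbed_zero/G0.
by move=> j nj; apply: G0; apply: leq_ltn_trans nj.
Qed.

(** Induction on k. If G covers M and is absorbed by Q, the composite
    G * P -> M * P -> V extends to an epimorphism rho from Q * P to V; its kernel L
    is orthogonal, since V is. The kernel K of G -> M need not be orthogonal, but L
    is a direct summand of K * (Q * P), because the endomorphism aP theta of Q * P
    lifts the identity of V, as in Schanuel's lemma. This is why a projective summand P is allowed. *)
Lemma pd_of_absorbed_resolution k V M P (s : {linear V -> (M * P)%type})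
    (r : {linear (M * P)%type -> V}) :
  absorbed_resolution k M -> projective_module P -> gp_orthogonal V ->
  (forall v, r (s v) = v) -> pd_le k V.
Proof.
elim: k V M P s r => [|k IHk] V M P s r /=.
  move=> M0 Pproj _ rs.
  have [s' s'E] : exists s' : {linear V -> P}, forall v, s' v = (s v).2.
    by apply: linear_of_fun => a x y; rewrite linearP.
  have [r' r'E] : exists r' : {linear P -> V}, forall x, r' x = r (0, x).
    apply: linear_of_fun => a x y; rewrite -linearP; congr (r (_, _)).
    by rewrite /= scaler0 addr0.
  apply: (projective_retract (i := s') (p := r')) => // v.
  rewrite r'E s'E -[RHS]rs; congr (r _).
  by case: (s v) => x y; rewrite [x]M0.
move=> [K [G [i [p [[Q [a [Qproj aV]]] ip Kres]]]]] Pproj oV rs.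
have [iinj ipE psurj] := ip.
have [rp rpE] : exists f : {linear G -> V}, forall x, f x = r (p x, 0).
  apply: linear_of_fun => c x y; rewrite -linearP; congr (r (_, _)).
    by rewrite linearP.
  by rewrite /= scaler0 addr0.
have [g gE] := aV V oV rp.
have [rho rhoE] : exists rho : {linear (Q * P)%type -> V},
    forall u, rho u = g u.1 + r (0, u.2).
  apply: linear_of_fun => c u v.
  have -> : (0, (c *: u + v).2) = c *: (0 : M, u.2) + (0, v.2).
    by congr (_, _); rewrite /= scaler0 addr0.
  by rewrite !linearP /= scalerDr addrACA.
pose GP : lmodType R := (G * P)%type; pose MP : lmodType R := (M * P)%type.
pose QP : lmodType R := (Q * P)%type.
have [pP pPE] : exists f : {linear GP -> MP}, forall u, f u = (p u.1, u.2).
  by apply: linear_of_fun => c u v; congr (_, _); rewrite /= linearP.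
have [aP aPE] : exists f : {linear GP -> QP}, forall u, f u = (a u.1, u.2).
  by apply: linear_of_fun => c u v; congr (_, _); rewrite /= linearP.
have QPproj : projective_module QP by apply: projective_prod.
have rho_aP u : rho (aP u) = r (pP u).
  rewrite rhoE aPE pPE /= gE rpE -linearD; congr (r (_, _)).
    by rewrite /= addr0.
  by rewrite /= add0r.
have pPsurj u : exists v, pP v = u.
  by have [x xE] := psurj u.1; exists (x, u.2); rewrite pPE /= xE; case: u {xE}.
have [theta thetaE] := QPproj _ _ pP (s \o rho) pPsurj.
have rho_theta x : rho (aP (theta x)) = rho x by rewrite rho_aP thetaE /= rs.
have rhosurj v : exists x, rho x = v.
  by have [u uE] := pPsurj (s v); exists (aP u); rewrite rho_aP uE rs.
have [L [l lrho]] := ses_of_epi rhosurj; have [linj lE _] := lrho.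
exists L, QP, l, rho; split=> //.
have rhol x : rho (l x) = 0 by apply/lE; exists x.
have oL : gp_orthogonal L.
  exact: gp_orthogonal_ker lrho (gp_orthogonal_projective QPproj) oV.
have [t1 t1E] : exists t1 : {linear L -> G}, forall x, t1 x = (theta (l x)).1.
  by apply: linear_of_fun => c x y; rewrite !linearP.
have ptheta x : pP (theta (l x)) = 0 by rewrite thetaE /= rhol linear0.
have [t tE] : exists t : {linear L -> K}, forall x, i (t x) = t1 x.
  apply: mono_lift => // x; apply/ipE; rewrite t1E.
  by have := ptheta x; rewrite pPE => -[].
have [i1 i1E] : exists i1 : {linear K -> QP}, forall x, i1 x = aP (i x, 0).
  apply: linear_of_fun => c x y; rewrite -linearP; congr (aP (_, _)).
    by rewrite linearP.
  by rewrite /= scaler0 addr0.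
have [u uE] : exists u : {linear (K * QP)%type -> L},
    forall z, l (u z) = i1 z.1 + (z.2 - aP (theta z.2)).
  have [f fE] : exists f : {linear (K * QP)%type -> QP},
      forall z, f z = i1 z.1 + (z.2 - aP (theta z.2)).
    apply: linear_of_fun => c y z.
    rewrite /= (linearP i1) (linearP theta) (linearP aP) opprD.
    by rewrite (addrACA (c *: y.2)) (addrACA (c *: i1 y.1)) !scalerDr scalerN.
  have [z|u uE] := mono_lift (f := f) linj; last by exists u => z; rewrite uE fE.
  apply/lE; rewrite fE linearD linearB rho_theta subrr addr0 i1E rho_aP pPE /=.
  have -> : p (i z.1) = 0 by apply/ipE; exists z.1.
  exact: linear0.
have [v vE] : exists v : {linear L -> (K * QP)%type}, forall x, v x = (t x, l x).
  by apply: linear_of_fun => c x y; congr (_, _); rewrite linearP.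
apply: (IHk L K QP v u) => // x; apply: linj; rewrite uE vE /= i1E tE t1E.
have -> : ((theta (l x)).1, 0) = theta (l x).
  by have := ptheta x; rewrite pPE => -[_]; case: (theta _) => ? ? /= ->.
by rewrite addrC subrK.
Qed.

Lemma pd_of_gp_orthogonal n V :
  absorbed_resolution n V -> gp_orthogonal V -> pd_le n V.
Proof.
pose P := free_mod R V; move=> Vres oV.
have [s sE] : exists s : {linear V -> (V * P)%type}, forall v, s v = (v, 0).
  by apply: linear_of_fun => a x y; congr (_, _); rewrite /= scaler0 addr0.
have [r rE] : exists r : {linear (V * P)%type -> V}, forall u, r u = u.1.
  by apply: linear_of_fun.
apply: (pd_of_absorbed_resolution (s := s) (r := r)) Vres _ oV _.
  exact: free_projective.
by move=> v; rewrite rE sE.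
Qed.

End Orthogonal.

(** * Filtered modules and reduced powers *)

Section WellOrder.
Variables (I : eqType) (le : rel I).
Hypothesis le_wo : well_order le.

Lemma wo_min (A : I -> Prop) : (exists i, A i) ->
  exists2 i, A i & forall j, A j -> le i j.
Proof.
move=> [i Ai].
have [|j [[/asboolP Aj jmin] _]] := le_wo (A := fun i => `[< A i >]).
  by exists i; apply/asboolP.
by exists j => // k Ak; apply/jmin/asboolP.
Qed.

Lemma wo_refl i : le i i.
Proof. by have [|_ -> ->] := @wo_min (fun j => j = i); first by exists i. Qed.

Lemma wo_total i j : le i j \/ le j i.
Proof.
have [|k [->|->] kmin] := @wo_min (fun k => k = i \/ k = j).
- by exists i; left.
- by left; apply: kmin; right.
- by right; apply: kmin; left.
Qed.

Lemma wo_antisym i j : le i j -> le j i -> i = j.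
Proof.
move=> ij ji; have [|k [_ kuniq]] := le_wo (A := pred2 i j).
  by exists i; rewrite inE eqxx.
have ik : k = i.
  apply: kuniq; split; first by rewrite inE eqxx.
  by move=> l; rewrite inE => /orP[] /eqP->; rewrite ?wo_refl.
rewrite -ik; apply: kuniq; split; first by rewrite inE eqxx orbT.
by move=> l; rewrite inE => /orP[] /eqP->; rewrite ?wo_refl.
Qed.

Lemma wo_trans i j k : le i j -> le j k -> le i k.
Proof.
move=> ij jk; have [|l lA lmin] := @wo_min (fun l => [\/ l = i, l = j | l = k]).
  by exists i; constructor 1.
have li : le l i by apply: lmin; constructor 1.
have lj : le l j by apply: lmin; constructor 2.
have lk : le l k by apply: lmin; constructor 3.
case: lA => lE; subst l => //.
  by rewrite (wo_antisym ij li).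
by rewrite -(wo_antisym jk lj).
Qed.

End WellOrder.

Section Eklof.
Variables (R : pzRingType) (I : eqType) (le : rel I).
Hypothesis le_wo : well_order le.

Definition down_closed (D : I -> Prop) : Prop := forall i j, le i j -> D j -> D i.

Definition linear_on (B N : lmodType R) (U : B -> Prop) (g : B -> N) : Prop :=
  forall a x y, U x -> U y -> g (a *: x + y) = a *: g x + g y.

Section Core.
Variables (B N : lmodType R) (U0 : B -> Prop) (F : I -> B -> Prop) (D0 : I -> Prop).
Hypotheses (Fmono : forall i j x, le i j -> F i x -> F j x)
  (U0F : forall i x, U0 x -> F i x) (D0down : down_closed D0)
  (U0_lin : forall a x y, U0 x -> U0 y -> U0 (a *: x + y))
  (F_lin : forall i a x y, F i x -> F i y -> F i (a *: x + y)).

Definition stage (D : I -> Prop) (x : B) : Prop := U0 x \/ exists2 i, D i & F i x.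

Hypothesis step : forall b (g : B -> N), D0 b ->
  linear_on (stage (fun j => ~~ le b j)) g ->
  exists2 g', linear_on (F b) g' &
    forall x, stage (fun j => ~~ le b j) x -> g' x = g x.

(** Zorn's lemma for the partial extensions to initial segments D of D0. *)
Lemma extend_along_filtration (g : B -> N) : linear_on U0 g ->
  exists2 g', linear_on (stage D0) g' & forall x, U0 x -> g' x = g x.
Proof.
move=> g_lin.
pose ok (D : I -> Prop) (h : B -> N) :=
  [/\ forall i, D i -> D0 i, down_closed D, linear_on (stage D) h
    & forall x, U0 x -> h x = g x].
pose ST : Type := {Dh : (I -> Prop) * (B -> N) | ok Dh.1 Dh.2}.
pose dom (t : ST) := (sval t).1; pose val (t : ST) := (sval t).2.
pose leS (t t' : ST) : bool := `[< (forall i, dom t i -> dom t' i) /\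
  forall x, stage (dom t) x -> val t' x = val t x >].
have stageS D D' x : (forall i, D i -> D' i) -> stage D x -> stage D' x.
  by move=> DD' [?|[i Di Fi]]; [left|right; exists i => //; apply: DD'].
have ok0 : ok (fun _ => False) g.
  by split=> // a x y [Ux|[] //] [Uy|[] //]; apply: g_lin.
have [|r t u|Ch tot|[[D h] Dh] tmax] :=
    @ZL_preorder ST (exist _ (_, g) ok0) leS.
- by move=> t; apply/asboolP.
- move=> /asboolP[rt rtE] /asboolP[tu tuE]; apply/asboolP; split=> [i /rt/tu//|x rx].
  by rewrite tuE ?rtE //; apply: stageS rx.
- have [[t1 Ch1]|no] := pselect (exists t, Ch t); last first.
    by exists (exist _ (_, g) ok0) => t Ct; case: no; exists t.
  pose D i := exists2 t, Ch t & dom t i.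
  have DS t i : Ch t -> dom t i -> D i by move=> Ct ti; exists t.
  have coh t t' x : Ch t -> Ch t' -> stage (dom t) x -> stage (dom t') x ->
      val t x = val t' x.
    move=> Ct Ct' tx t'x.
    have [/asboolP[_ tt']|/asboolP[_ t't]] := tot _ _ Ct Ct'.
      by rewrite tt'.
    by rewrite t't.
  have stageD x : stage D x -> exists2 t, Ch t & stage (dom t) x.
    move=> [U0x|[i [t Ct ti] Fi]]; first by exists t1 => //; left.
    by exists t => //; right; exists i.
  have common x y : stage D x -> stage D y ->
      exists t, [/\ Ch t, stage (dom t) x & stage (dom t) y].
    move=> /stageD[t Ct tx] /stageD[t' Ct' t'y].
    have [/asboolP[tt' _]|/asboolP[t't _]] := tot _ _ Ct Ct'.
      by exists t'; split=> //; apply: stageS tx.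
    by exists t; split=> //; apply: stageS t'y.
  have /choice[h hE] : forall x, exists y, forall t, Ch t -> stage (dom t) x ->
      y = val t x.
    move=> x.
    have [[t Ct tx]|no] := pselect (exists2 t, Ch t & stage (dom t) x).
      by exists (val t x) => t' Ct'; apply: coh.
    by exists 0 => t Ct tx; case: no; exists t.
  have okh : ok D h.
    split.
    - by move=> i [t Ct ti]; have [tD _ _ _] := svalP t; apply: tD.
    - move=> i j ij [t Ct tj]; exists t => //.
      by have [_ tdown _ _] := svalP t; apply: tdown tj.
    - move=> a x y Dx Dy; have [t [Ct tx ty]] := common _ _ Dx Dy.
      have [_ tdown tlin _] := svalP t.
      rewrite (hE x t) // (hE y t) // -tlin //; apply: hE => //.
      case: tx ty => [Ux|[i ti Fx]] [Uy|[j tj Fy]].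
      + by left; apply: U0_lin.
      + by right; exists j => //; apply: F_lin => //; apply: U0F.
      + by right; exists i => //; apply: F_lin => //; apply: U0F.
      + have [ij|ji] := wo_total le_wo i j.
          by right; exists j => //; apply: F_lin => //; apply: Fmono ij _.
        by right; exists i => //; apply: F_lin => //; apply: Fmono ji _.
    - move=> x U0x; rewrite (hE x t1) //; last by left.
      by have [_ _ _ t1g] := svalP t1; apply: t1g.
  exists (exist _ (D, h) okh) => t Ct; apply/asboolP.
  split=> [i|x tx]; first exact: DS.
  exact: hE.
have [DD0 Ddown hlin hg] := Dh; rewrite /= in DD0 Ddown hlin hg.
suff D0D i : D0 i -> D i.
  exists h => // a x y D0x D0y.
  by apply: hlin; apply: stageS D0D _.
move=> D0i; apply: contrapT => Di.
have [|b [D0b Db] bmin] := @wo_min _ _ le_wo (fun j => D0 j /\ ~ D j).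
  by exists i.
have Dlt j : D j <-> ~~ le b j.
  split=> [Dj|bj]; first by apply/negP => bj; apply: Db; apply: Ddown bj Dj.
  apply: contrapT => nDj; have jb : le j b.
    by have [//|bj'] := wo_total le_wo j b; rewrite bj' in bj.
  by case/negP: bj; apply: bmin; split=> //; apply: D0down jb D0b.
have stageE x : stage D x <-> stage (fun j => ~~ le b j) x.
  by split; apply: stageS => j /Dlt.
have [|h' h'lin h'E] := step (g := h) D0b.
  by move=> a x y /stageE Dx /stageE Dy; apply: hlin.
have stageb x : stage (fun j => D j \/ j = b) x -> F b x.
  move=> [/U0F//|[j [Dj|->]//]]; apply: Fmono.
  by have [//|bj] := wo_total le_wo j b; move/Dlt/negP: Dj.
have ok' : ok (fun j => D j \/ j = b) h'.
  split.
  - by move=> j [/DD0|->].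
  - move=> j k jk [Dk|kb]; first by left; apply: Ddown jk Dk.
    subst k; have [bj|/negP nbj] := pselect (le b j).
      by right; apply: (wo_antisym le_wo).
    by left; apply/Dlt.
  - by move=> a x y /stageb Fx /stageb Fy; apply: h'lin.
  - by move=> x U0x; rewrite h'E ?hg //; left.
have leT : leS (exist _ (D, h) Dh) (exist _ (_, h') ok').
  by apply/asboolP; split=> [j|x /stageE]; [left|apply: h'E].
have := tmax _ leT => /asboolP[/(_ b) tb _].
by apply: Db; apply: tb; right.
Qed.

End Core.
End Eklof.

Section FilteredExt.
Variable R : pzRingType.

Definition represents (X : lmodType R) (U : X -> Prop) (K : lmodType R)
  (i : {linear K -> X}) : Prop := injective i /\ forall x, U x <-> exists k, i k = x.

(** The hypotheses on q make Q isomorphic to V/U, hence also to the quotient of the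
    preimages of V and U in B. *)
Lemma extend_by_quotient (B X N K Q : lmodType R) (p : {linear B -> X})
    (U V : X -> Prop) (k : {linear K -> X}) (q : {linear K -> Q}) (g : B -> N) :
  (forall x, exists b, p b = x) -> (forall x, U x -> V x) -> represents V k ->
  (forall d, exists y, q y = d) -> (forall y, q y = 0 <-> U (k y)) ->
  ext1_zero Q N -> linear_on (fun b => U (p b)) g ->
  exists2 g', linear_on (fun b => V (p b)) g' & forall b, U (p b) -> g' b = g b.
Proof.
move=> psurj UV [kinj kV] qsurj qU ext glin.
have U0 : U 0 by rewrite -(linear0 k); apply/qU; apply: linear0.
have Ulin a x y : U x -> U y -> U (a *: x + y).
  move=> Ux Uy; have [[x' x'E] [y' y'E]] := ((kV x).1 (UV _ Ux), (kV y).1 (UV _ Uy)).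
  rewrite -x'E -y'E -linearP; apply/qU; rewrite linearP.
  have /qU -> : U (k x') by rewrite x'E.
  have /qU -> : U (k y') by rewrite y'E.
  by rewrite scaler0 addr0.
have [|BV [v [vinj vE]]] := @submodule_of_pred R B (fun b => V (p b)).
  split=> [|a x y Vx Vy]; first by rewrite linear0; apply: UV.
  have [[x' x'E] [y' y'E]] := ((kV _).1 Vx, (kV _).1 Vy).
  by apply/kV; exists (a *: x' + y'); rewrite !linearP x'E y'E.
have [|BU [u [uinj uE]]] := @submodule_of_pred R B (fun b => U (p b)).
  split=> [|a x y Ux Uy]; first by rewrite linear0.
  by rewrite linearP; apply: Ulin.
have Vv y : V (p (v y)) by apply/vE; exists y.
have Uu y : U (p (u y)) by apply/uE; exists y.
have [y|j jE] := mono_lift (f := u) vinj; first by apply/vE/UV.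
have [y|t tE] := mono_lift (f := p \o v) kinj; first by apply/kV/Vv.
have [f fE] : exists f : {linear BU -> N}, forall y, f y = g (u y).
  by apply: linear_of_fun => a x y; rewrite linearP glin.
have [|h hE] := ext BU BV j (q \o t) _ f.
  split.
  - by move=> x y /(congr1 v); rewrite !jE => /uinj.
  - move=> y; split=> [/qU|[z <-]]; last by apply/qU; rewrite tE /= jE.
    rewrite tE => /= /uE[z zE]; exists z; apply: vinj.
    by rewrite jE zE.
  - move=> d; have [y yE] := qsurj d; have [b bE] := psurj (k y).
    have /vE[z zE] : V (p b) by rewrite bE; apply/kV; exists y.
    exists z; rewrite /= -yE; congr (q _); apply: kinj.
    by rewrite tE /= zE bE.
have /choice[g' g'E] : forall b, exists n, forall z, v z = b -> n = h z.
  move=> b; have [[z zE]|no] := pselect (exists z, v z = b).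
    by exists (h z) => z' z'E; congr (h _); apply: vinj; rewrite zE.
  by exists 0 => z zE; case: no; exists z.
exists g' => [a x y /vE[x' xE] /vE[y' yE]|b /uE[z zE]].
  have vxy : v (a *: x' + y') = a *: x + y by rewrite linearP xE yE.
  by rewrite (g'E _ _ vxy) (g'E _ _ xE) (g'E _ _ yE) linearP.
by rewrite (g'E _ (j z)) ?jE // hE fE zE.
Qed.

Variables (I : eqType) (le : rel I).
Hypothesis le_wo : well_order le.

(** Eklof's lemma: Ext^1(-, N) = 0 is inherited along well-ordered filtrations. *)
Lemma ext1_filtered (X N : lmodType R) (F : I -> X -> Prop) (D0 : I -> Prop) :
  (forall i j x, le i j -> F i x -> F j x) -> (forall i, is_submod (F i)) ->
  down_closed le D0 ->
  (forall x, x = 0 \/ exists2 i, D0 i & F i x) ->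
  (forall b, D0 b ->
     exists (K Q : lmodType R) (k : {linear K -> X}) (q : {linear K -> Q}),
    [/\ represents (F b) k, forall d, exists y, q y = d,
        forall y, q y = 0 <-> (k y = 0 \/ exists2 j, ~~ le b j & F j (k y))
      & ext1_zero Q N]) ->
  ext1_zero X N.
Proof.
move=> Fmono Fsub D0down cover quo A B i p [iinj ipE psurj] f.
pose U0 b := p b = 0.
have /choice[g0 g0E] : forall b, exists n, forall a, i a = b -> n = f a.
  move=> b; have [[a aE]|no] := pselect (exists a, i a = b).
    by exists (f a) => a' a'E; congr (f _); apply: iinj; rewrite aE.
  by exists 0 => a aE; case: no; exists a.
pose F' j b := F j (p b).
have F'mono j k x : le j k -> F' j x -> F' k x by move=> jk; apply: Fmono.
have U0F' j x : U0 x -> F' j x by rewrite /U0 /F' => ->; apply: (Fsub j).1.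
have U0lin a x y : U0 x -> U0 y -> U0 (a *: x + y).
  by rewrite /U0 linearP => -> ->; rewrite scaler0 addr0.
have F'lin j a x y : F' j x -> F' j y -> F' j (a *: x + y).
  by move=> Fx Fy; rewrite /F' linearP; apply: (Fsub j).2.
have g0lin : linear_on U0 g0.
  move=> a x y /ipE[x' xE] /ipE[y' yE].
  have ixy : i (a *: x' + y') = a *: x + y by rewrite linearP xE yE.
  by rewrite (g0E _ _ ixy) (g0E _ _ xE) (g0E _ _ yE) linearP.
have step b (g : B -> N) : D0 b -> linear_on (stage U0 F' (fun j => ~~ le b j)) g ->
    exists2 g', linear_on (F' b) g' &
      forall x, stage U0 F' (fun j => ~~ le b j) x -> g' x = g x.
  move=> D0b glin; have [K [Q [k [q [kF qsurj qE ext]]]]] := quo b D0b.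
  have UF x : (x = 0 \/ exists2 j, ~~ le b j & F j x) -> F b x.
    move=> [->|[j bj]]; first exact: (Fsub b).1.
    by apply: Fmono; have [bj'|//] := wo_total le_wo b j; rewrite bj' in bj.
  exact: (extend_by_quotient psurj UF kF qsurj qE ext glin).
have [g glin gE] :=
  extend_along_filtration le_wo F'mono U0F' D0down U0lin F'lin step g0lin.
have covB b : stage U0 F' D0 b.
  by have [?|[j D0j Fj]] := cover (p b); [left|right; exists j].
have [h hE] : exists h : {linear B -> N}, forall b, h b = g b.
  by apply: linear_of_fun => a x y; apply: glin.
exists h => a; rewrite hE gE ?(g0E _ a) //.
by apply/ipE; exists a.
Qed.

End FilteredExt.

Section ReducedPower.
Variables (R : pzRingType) (L : lmodType R) (B : eqType).
Hypothesis oL : gp_orthogonal L.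
Variable n : nat.
Hypothesis pd_orth : forall V : lmodType R, gp_orthogonal V -> pd_le n V.

Local Notation W := (seq B -> L : lmodType R).

(** If D and T are everything, W modulo the negligible families is the reduced power
    of L with respect to the filter generated by the sets of all lists t that
    contain b. The conditions b in D filter the module of negligible families;
    T is there because the subquotients are again of this kind, see
    negligible_quotient. *)
Definition negligible (D : B -> Prop) (T : seq B -> Prop) (x : W) : Prop :=
  (forall t, ~ T t -> x t = 0) /\
  exists2 u : seq B, (forall b, b \in u -> D b) &
    forall t, {subset u <= t} -> x t = 0.

Lemma negligible_submod D T : is_submod (negligible D T).
Proof.
split=> [|a x y [xT [u uD ux]] [yT [v vD vy]]].
  by split=> //; exists [::].
split=> [t Tt|].
  by rewrite -[LHS]/(a *: x t + y t) xT // yT // scaler0 addr0.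
exists (u ++ v) => [b|t uvt]; first by rewrite mem_cat => /orP[/uD|/vD].
rewrite -[LHS]/(a *: x t + y t) ux ?vy ?scaler0 ?addr0 // => b bu.
  by apply: uvt; rewrite mem_cat bu orbT.
by apply: uvt; rewrite mem_cat bu.
Qed.

Lemma negligible_sub D D' T x : (forall b, D b -> D' b) ->
  negligible D T x -> negligible D' T x.
Proof. by move=> DD' [xT [u uD ux]]; split=> //; exists u => // b /uD/DD'. Qed.

Lemma orthogonal_support (T : seq B -> Prop) (K : lmodType R)
    (i : {linear K -> W}) :
  represents (fun x => forall t, ~ T t -> x t = 0) i -> gp_orthogonal K.
Proof.
move=> [iinj iE].
have [r rE] : exists r : {linear W -> W},
    forall x, r x = fun t => if `[< T t >] then x t else 0.
  apply: linear_of_fun => a x y; apply: funext => t.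
  rewrite -[RHS]/(a *: (if `[< T t >] then x t else 0) +
                  (if `[< T t >] then y t else 0)).
  by case: asboolP => //; rewrite scaler0 addr0.
have [x|p pE] := mono_lift (f := r) iinj.
  by apply/iE => t Tt; rewrite rE; case: asboolP.
apply: (gp_orthogonal_retract (i := i) (p := p)); last exact: gp_orthogonal_fun oL.
move=> k; apply: iinj; rewrite pE rE; apply: funext => t.
case: asboolP => // Tt; apply/esym.
have /iE ikT : exists k', i k' = i k by exists k.
exact: ikT.
Qed.

Variable le : rel B.
Hypothesis le_wo : well_order le.

Lemma seq_max (D : B -> Prop) (u : seq B) : (forall b, b \in u -> D b) ->
  u = [::] \/ exists2 b, D b & forall c, c \in u -> le c b.
Proof.
elim: u => [|c u IHu] uD; [by left|right].
have [|->|[b Db bmax]] := IHu; first by move=> d du; apply: uD; rewrite inE du orbT.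
  exists c; first by apply: uD; rewrite mem_head.
  by move=> d; rewrite inE => /eqP->; apply: wo_refl.
have Dc : D c by apply: uD; rewrite mem_head.
have [cb|bc] := wo_total le_wo c b.
  by exists b => // d; rewrite inE => /predU1P[->|/bmax].
exists c => // d; rewrite inE => /predU1P[->|/bmax db]; first exact: wo_refl.
exact: (wo_trans le_wo) db bc.
Qed.

(** Adjoining b to the segment below it adds the families supported on the lists
    that miss b. Hence the subquotient is a power of L modulo negligible families
    for this segment and the set T' of the lists in T that miss b. *)
Lemma negligible_quotient b (T : seq B -> Prop) (K : lmodType R)
    (k : {linear K -> W}) :
  (forall (T' : seq B -> Prop) (K' : lmodType R) (k' : {linear K' -> W}),
    represents (negligible (fun c => ~~ le b c) T') k' -> gp_orthogonal K') ->
  represents (negligible (le^~ b) T) k ->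
  exists (Q : lmodType R) (q : {linear K -> Q}),
    [/\ forall d, exists y, q y = d,
        forall y, q y = 0 <-> negligible (fun c => ~~ le b c) T (k y)
      & gp_orthogonal Q].
Proof.
move=> IH [kinj kE]; pose lt c := ~~ le b c.
have [|Q [q [qsurj qE]]] := @quotient_by_pred R K (fun y => negligible lt T (k y)).
  have [N0 Nlin] := negligible_submod lt T.
  by split=> [|a x y Nx Ny]; [rewrite linear0|rewrite linearP; apply: Nlin].
exists Q, q; split=> //.
pose T' t := T t /\ b \notin t.
have [|V [v [vinj vE]]] :=
    @submodule_of_pred R W (fun x => forall t, ~ T' t -> x t = 0).
  split=> // a x y xT yT t Tt.
  by rewrite -[LHS]/(a *: x t + y t) xT // yT // scaler0 addr0.
have [y|j jE] := mono_lift (f := v) kinj.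
  have vT' : forall t, ~ T' t -> v y t = 0 by apply/vE; exists y.
  apply/kE; split=> [t Tt|]; first by apply: vT' => -[].
  exists [:: b] => [c|t bt]; first by rewrite inE => /eqP->; apply: wo_refl.
  by apply: vT' => -[_]; rewrite bt ?mem_head.
have qjsurj d : exists y, (q \o j) y = d.
  have [y yd] := qsurj d.
  have [yT [u ub uy]] : negligible (le^~ b) T (k y) by apply/kE; exists y.
  pose z : W := fun t => if b \in t then 0 else k y t.
  have /vE[y' y'E] : forall t, ~ T' t -> z t = 0.
    move=> t T't; rewrite /z; case: ifPn => // bt; apply: yT => Tt.
    exact: T't.
  exists y'; rewrite -yd /=; apply/eqP.
  rewrite eq_sym -subr_eq0 -linearB; apply/eqP/qE.
  rewrite linearB jE y'E; split=> [t Tt|].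
    by rewrite -[LHS]/(k y t - z t) /z yT //; case: ifP; rewrite subrr.
  exists [seq c <- u | lt c] => [c|t ut]; first by rewrite mem_filter => /andP[].
  rewrite -[LHS]/(k y t - z t) /z; case: ifPn => [bt|]; last by rewrite subrr.
  rewrite subr0; apply: uy => c cu; have [ltc|] := boolP (lt c).
    by apply: ut; rewrite mem_filter ltc.
  by rewrite negbK => bc; rewrite (wo_antisym le_wo (ub _ cu) bc).
have [V' [v' v'ses]] := ses_of_epi qjsurj; have [v'inj v'E _] := v'ses.
apply: gp_orthogonal_coker v'ses _ (orthogonal_support (conj vinj vE)).
apply: (IH T' V' (v \o v')); split=> [x y /vinj/v'inj //|x].
split=> [[xT' [u ult ux]]|[y <-]].
  have /vE[y yE] : forall t, ~ T' t -> x t = 0 by [].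
  have /v'E[y' y'E] : (q \o j) y = 0.
    apply/qE; rewrite jE yE; split=> [t Tt|]; first by apply: xT' => -[].
    by exists u.
  by exists y'; rewrite /= y'E.
have vT : forall t, ~ T' t -> (v \o v') y t = 0 by apply/vE; exists (v' y).
have /qE : (q \o j) (v' y) = 0 by apply/v'E; exists y.
by rewrite jE => -[_ ?]; split.
Qed.

(** The filtration by the segments up to b has orthogonal subquotients. Since the
    projective dimensions of these are uniformly bounded, Eklof's lemma
    applies. *)
Lemma negligible_segment (D : B -> Prop) : down_closed le D ->
  (forall b, D b ->
     forall (T : seq B -> Prop) (K : lmodType R) (k : {linear K -> W}),
    represents (negligible (fun c => ~~ le b c) T) k -> gp_orthogonal K) ->
  forall (T : seq B -> Prop) (K : lmodType R) (k : {linear K -> W}),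
    represents (negligible D T) k -> gp_orthogonal K.
Proof.
move=> Ddown IH T K k [kinj kE]; apply: (@gp_orthogonal_pd R n).
apply: pd_of_ext1 => N Ncos.
pose F b y := negligible (le^~ b) T (k y).
have ltW b c : ~~ le b c -> le c b.
  by move=> bc; have [//|bc'] := wo_total le_wo c b; rewrite bc' in bc.
apply: (ext1_filtered le_wo (F := F) (D0 := D)) => //.
- by move=> b c y bc; apply: negligible_sub => d db; apply: wo_trans db bc.
- move=> b; have [N0 Nlin] := negligible_submod (le^~ b) T.
  by split=> [|a x y Nx Ny]; rewrite /F ?linear0 // linearP; apply: Nlin.
- move=> y; have [yT [u uD uy]] : negligible D T (k y) by apply/kE; exists y.
  have [u0|[b Db bmax]] := seq_max uD; last first.
    by right; exists b => //; split=> //; exists u.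
  left; apply: kinj; rewrite linear0; apply: funext => t; apply: uy.
  by rewrite u0.
move=> b Db.
have [|Kb [i [iinj iE]]] := @submodule_of_pred R W (negligible (le^~ b) T).
  exact: negligible_submod.
have [Q [q [qsurj qE oQ]]] := negligible_quotient (IH b Db) (conj iinj iE).
have [y|j jE] := mono_lift (f := i) kinj.
  have /iE : exists y', i y' = i y by exists y.
  move=> iy; apply/kE; move: iy; apply: negligible_sub => c cb; apply: Ddown cb Db.
exists Kb, Q, j, q; split=> //.
- split=> [x y /(congr1 k)|y]; first by rewrite !jE => /iinj.
  split=> [/iE[z zE]|[z <-]]; last by rewrite /F jE; apply/iE; exists z.
  by exists z; apply: kinj; rewrite jE.
- move=> y; rewrite qE /F jE; split=> [[yT [u ub uy]]|].
    have [u0|[c bc cmax]] := seq_max ub; last first.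
      by right; exists c => //; split=> //; exists u.
    left; apply: kinj; rewrite linear0 jE; apply: funext => t; apply: uy.
    by rewrite u0.
  move=> [y0|[c bc]].
    have -> : i y = 0 by rewrite -jE y0 linear0.
    exact: (negligible_submod _ _).1.
  apply: negligible_sub => d dc; apply/negP => bd.
  by case/negP: bc; apply: wo_trans bd dc.
- exact: ext1_pd (pd_orth oQ) Ncos.
Qed.

(** Well-founded induction on initial segments. *)
Lemma orthogonal_negligible D T (K : lmodType R) (k : {linear K -> W}) :
  down_closed le D -> represents (negligible D T) k -> gp_orthogonal K.
Proof.
move=> Ddown; apply: negligible_segment => // b _.
apply: contrapT => nb.
have [|c nc cmin] := @wo_min _ _ le_wo (fun b => ~ forall (T : seq B -> Prop)
    (K : lmodType R) (k : {linear K -> W}),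
    represents (negligible (fun c => ~~ le b c) T) k -> gp_orthogonal K).
  by exists b.
apply: nc => T' K' k'; apply: negligible_segment => [i j ij cj|d cd].
  by apply: contra cj => ci; apply: wo_trans ci ij.
by apply: contrapT => /cmin cd'; rewrite cd' in cd.
Qed.

End ReducedPower.

(** * Tensor exactness from finite Gorenstein dimensions *)

Section TensorExact.
Variables (R : pzRingType) (C : complex R).
Hypothesis Ctot : totally_acyclic C.
Variable n : nat.
Hypothesis pd_orth : forall V : lmodType R, gp_orthogonal V -> pd_le n V.

Lemma tensor_map_comp0 (E : lmodType R^c) m (t : tensor E (C (m + 1 + 1))) :
  tensor_map (cdiff C m) (tensor_map (cdiff C (m + 1)) t) = 0.
Proof.
have [r ->] := tensor_sum t; rewrite !raddf_sum big1 // => u _ /=.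
by rewrite !tensor_map_mk cdiff_comp tmk0r.
Qed.

Section Cofree.
Variables (Y : eqType) (m : int).
Local Notation E := (cofree R^c Y).
Local Notation L := (free_mod R Y).
Variable r : seq (E * C (m + 1)%R).
Hypothesis dr : \sum_(u <- r) tmk u.1 (cdiff C m u.2) = 0.

(* The pairing of f with the cycle represented by r. *)
Let value (f : {linear C (m + 1)%R -> L}) : rational_circle :=
  \sum_(u <- r) pairing u.1 (f u.2).

Let value_coboundary (h : {linear C m -> L}) (f : {linear C (m + 1)%R -> L}) :
  (forall u, u \in r -> f u.2 = h (cdiff C m u.2)) -> value f = 0.
Proof.
move=> fh.
have [Psi PsiE] : exists Psi : {additive tensor E (C m) -> rational_circle},
    forall e c, Psi (tmk e c) = pairing e (h c).
  apply: tensor_lift_exists.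
  - by move=> c; apply: pairingDl.
  - by move=> e c c'; rewrite !raddfD.
  - by move=> a e c; rewrite pairingZ linearZ.
transitivity (Psi 0); last exact: raddf0.
rewrite -dr raddf_sum; apply: eq_big_seq => u ur /=.
by rewrite PsiE fh.
Qed.

(** Otherwise choose for every finite list w a cochain F w closed on w with nonzero
    value. Together they form a cocycle with values in a reduced power of L, which
    is a coboundary because the reduced power is orthogonal; hence F w agrees with
    a coboundary on the finitely many elements in question, for some w. *)
Lemma value_finite : exists w : seq (C (m + 1 + 1)%R),
  forall f : {linear C (m + 1)%R -> L},
    (forall y, y \in w -> f (cdiff C (m + 1) y) = 0) -> value f = 0.
Proof.
apply: contrapT => /forallNP bad.
have /choice[F FP] : forall w : seq (C (m + 1 + 1)%R),
    exists f : {linear C (m + 1)%R -> L},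
    (forall y, y \in w -> f (cdiff C (m + 1) y) = 0) /\ value f <> 0.
  by move=> w; have /existsNP[f /not_implyP[fw fv]] := bad w; exists f.
pose W : lmodType R := (seq (C (m + 1 + 1)%R) -> L).
have [le le_wo] := well_ordering_principle (C (m + 1 + 1)%R).
have oL : gp_orthogonal L.
  by apply: gp_orthogonal_projective; apply: free_projective.
pose Z := @negligible R L (C (m + 1 + 1)%R) (fun _ => True) (fun _ => True).
have [|K [k [kinj kE]]] := @submodule_of_pred R W Z; first exact: negligible_submod.
have oK : gp_orthogonal K.
  exact: (orthogonal_negligible oL pd_orth le_wo _ (conj kinj kE)).
have [Q [q kq]] := ses_of_mono kinj; have [_ qE qsurj] := kq.
have oQ : gp_orthogonal Q := gp_orthogonal_coker kq oK (gp_orthogonal_fun oL).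
have qZ x : q x = 0 <-> Z x by rewrite qE kE.
have [f fE] : exists f : {linear C (m + 1)%R -> W},
    forall c, f c = fun w => F w c.
  by apply: linear_of_fun => a c c'; apply: funext => w; rewrite linearP.
have [y|h hE] := oQ C Ctot m (q \o f).
  apply/qZ; split=> //; exists [:: y] => // w yw; rewrite fE.
  by apply: (FP w).1; apply: yw; rewrite mem_head.
have [Cproj _ _] := Ctot; have [h' h'E] := @Cproj m _ _ q h qsurj.
have /choice[u uP] : forall c, exists u : seq (C (m + 1 + 1)%R),
    forall w, {subset u <= w} -> f c w = h' (cdiff C m c) w.
  move=> c; have /qZ[_ [u _ uP]] : q (f c - h' (cdiff C m c)) = 0.
    by rewrite linearB h'E hE subrr.
  by exists u => w uw; apply/eqP; rewrite -subr_eq0; apply/eqP/uP.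
pose w := flatten [seq u v.2 | v <- r].
have [hw hwE] : exists hw : {linear C m -> L}, forall c, hw c = h' c w.
  by apply: linear_of_fun => a c c'; rewrite linearP.
apply: (FP w).2; apply: (value_coboundary (h := hw)) => v vr.
have := uP v.2 w; rewrite fE hwE; apply=> b bu.
by apply/flatten_mapP; exists v.
Qed.

(** By value_finite, the value of f is determined by its restriction to the
    boundaries of the elements of w; Q/Z being divisible, it is obtained from this
    restriction by characters of L, which are the coefficients of t'. *)
Lemma cofree_boundary : exists t' : tensor E (C (m + 1 + 1)),
  tensor_map (cdiff C (m + 1)) t' = \sum_(u <- r) tmk u.1 u.2.
Proof.
have [w wP] := value_finite; pose d := cdiff C (m + 1).
pose k := size w; pose y (j : 'I_k) := tnth (in_tuple w) j.
pose A : zmodType := ('I_k -> L).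
have [|||eps epsE] := @divisible_extend rational_circle A
  (fun a z => exists f : {linear C (m + 1)%R -> L},
    (forall j, a j = f (d (y j))) /\ z = value f)
  rational_circle_divisible.
- have [f f0] := zero_linear (C (m + 1)) L.
  exists f; split=> [j|]; first by rewrite f0.
  by rewrite /value big1 // => u _; rewrite f0 raddf0.
- move=> a _ a' _ [f [fE ->]] [g [gE ->]].
  exists (f \- g); split=> [j|]; first by rewrite /= -fE -gE.
  by rewrite /value -sumrB; apply: eq_bigr => u _; rewrite -raddfB.
- move=> _ [f [f0 ->]]; apply: wP => z zw.
  have /tnthP[j ->] : z \in in_tuple w by [].
  by rewrite -/d -/(y j) -f0.
have eP j v : zmod_morphism (fun c : R^c => eps (single j ((c : R) *: gen R v))).
  by move=> c c'; rewrite [in LHS]scalerBl singleB raddfB.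
pose e (j : 'I_k) : E := fun v => Coind (eP j v).
have [Cproj _ _] := Ctot.
have [p [s [pE ps]]] := projective_section (@Cproj (m + 1)).
exists (\sum_j tmk (e j) (y j)); rewrite raddf_sum.
under eq_bigr => j _ do rewrite /= tensor_map_mk.
apply: (tensor_eq_coords pE ps) => x; apply: funext => v; apply: coind_ext => c.
rewrite !cofree_sumE !coind_sumE.
have [f fE] : exists f : {linear C (m + 1)%R -> L},
    forall z, f z = (s z x : R) *: ((c : R) *: gen R v).
  move: (_ *: gen R v) => l; apply: linear_of_fun => b z z'.
  by rewrite linearP scalerA -scalerDl.
transitivity (eps (fun j => f (d (y j)))).
  rewrite [X in eps X]single_sum raddf_sum; apply: eq_bigr => j _.
  by rewrite fE scalerA.
rewrite (epsE _ (value f)); last by exists f.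
by apply: eq_bigr => u _; rewrite fE scalerA pairingE.
Qed.

End Cofree.

(** Every injective right module is a direct summand of the character module of
    a free module. *)
Lemma injective_tensor_exact (E : lmodType R^c) :
  injective_module E -> tensor_exact E C.
Proof.
move=> Einj m t; split=> [dt|[t' <-]]; last exact: tensor_map_comp0.
have [Y [i iinj]] := cofree_embedding E.
have [rho rhoE] := Einj _ _ i idfun iinj.
have [r tE] := tensor_sum t; pose r' := [seq (i u.1, u.2) | u <- r].
have [Mi MiE] : exists Mi :
    {additive tensor E (C m) -> tensor (cofree R^c Y) (C m)},
    forall e c, Mi (tmk e c) = tmk (i e) c.
  apply: tensor_lift_exists => [c e e'|e c c'|a e c]; rewrite ?linearD.
  - exact: tmkDl.
  - exact: tmkDr.
  - by rewrite linearZ tmkZ.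
have [|t' t'E] := @cofree_boundary Y m r'.
  rewrite /r' big_map /= -[RHS](raddf0 Mi) -dt tE !raddf_sum.
  by apply: eq_bigr => u _; rewrite /= tensor_map_mk MiE.
have [q qE] := tensor_sum t'.
exists (\sum_(u <- q) tmk (rho u.1) u.2).
have [Mr MrE] : exists Mr :
    {additive tensor (cofree R^c Y) (C (m + 1)%R) -> tensor E (C (m + 1)%R)},
    forall e c, Mr (tmk e c) = tmk (rho e) c.
  apply: tensor_lift_exists => [c e e'|e c c'|a e c]; rewrite ?linearD.
  - exact: tmkDl.
  - exact: tmkDr.
  - by rewrite linearZ tmkZ.
transitivity (Mr (\sum_(u <- r') tmk u.1 u.2)).
  rewrite -t'E qE !raddf_sum; apply: eq_bigr => u _ /=.
  by rewrite !tensor_map_mk MrE.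
rewrite tE raddf_sum big_map; apply: eq_bigr => u _ /=.
by rewrite MrE rhoE.
Qed.

End TensorExact.

Section Suprema.
Variable R : pzRingType.

Lemma least_le (P : nat -> Prop) n :
  enat_le (least P) (Some n) <-> exists2 k, (k <= n)%N & P k.
Proof.
split=> [|[k kn Pk]].
  by case E: (least P) => [k|//] /= kn; exists k => //; have /leastP[] := E.
case E: (least P) => [j|]; last by have /least_None/(_ k) := E.
by have /leastP[_ /(_ k Pk) jk] := E; apply: leq_trans kn.
Qed.

Lemma resolution_sub (X X' : lmodType R -> Prop) M k :
  (forall G, X G -> X' G) -> has_resolution X M k -> has_resolution X' M k.
Proof.
move=> XX' [G [d [e [GX ? ? ? ?]]]]; exists G, d, e; split=> //.
by move=> i /GX/XX'.
Qed.

(** The hypothesis enters only through the uniform bound n + 1 on the projective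
    dimensions of orthogonal modules. *)
Lemma gorenstein_projective_PGF n :
  (forall M : lmodType R, enat_le (Gpd M) (Some n)) ->
  forall M : lmodType R, gorenstein_projective M -> PGF M.
Proof.
move=> Gn M [C [Cproj Cex CQ CM]]; exists C; split=> // E Einj.
apply: (@injective_tensor_exact R C _ n.+1 _ E Einj); first by [].
move=> V oV; have /least_le[k kn Vres] := Gn V.
exact: pd_of_gp_orthogonal (gp_resolution_absorbed kn Vres) oV.
Qed.

End Suprema.

Local Open Scope classical_set_scope.

Theorem theoremC (R : pzRingType) :
  esup [set d : enat | exists M : lmodType R, d = PGF_pd M] =
  esup [set d : enat | exists M : lmodType R, d = Gpd M].
Proof.
have bounds n : (forall M : lmodType R, enat_le (PGF_pd M) (Some n)) <->
    (forall M : lmodType R, enat_le (Gpd M) (Some n)).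
  split=> Hn M; have /least_le[k kn Mres] := Hn M; apply/least_le; exists k => //.
    by apply: resolution_sub Mres; apply: PGF_gorenstein_projective.
  by apply: resolution_sub Mres; apply: gorenstein_projective_PGF Hn.
rewrite /esup; congr least; apply: funext => n; apply/propext; split.
  by move=> H _ [M ->]; apply: (bounds n).1 => M'; apply: H; exists M'.
by move=> H _ [M ->]; apply: (bounds n).2 => M'; apply: H; exists M'.
Qed.
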